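(* Let $g:\mathbb{R}^n\times\mathbb{R}^m\to\mathbb{R}$ be a $C^2$ semi-algebraic function. Then the set of vectors $a\in\mathbb{R}^m$ such that the function $(x,y)\mapsto g(x,y)-\langle a,y\rangle$ is piecewise parametric Morse is semi-algebraic and dense in $\mathbb{R}^m$ (hence residual and of full measure).
   Context: A $C^2$ function $\phi:\mathbb{R}^m\to\mathbb{R}$ is Morse if $\nabla^2\phi(y)$ is invertible at every critical point $y$ of $\phi$. A $C^2$ function $h:\mathbb{R}^n\times\mathbb{R}^m\to\mathbb{R}$ is piecewise parametric Morse if there is an open dense subset of $\mathbb{R}^n$ such that $h(x,\cdot)$ is Morse for every $x$ in this subset. *)

(* Defs.v *)
From HB Require Import structures.
From mathcomp Require Import all_boot all_order all_algebra.
From mathcomp Require Import all_classical all_reals all_analysis.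
(* Not imported: the notations of mpoly clash with those of all_analysis. *)
From mathcomp Require mpoly.

Set Implicit Arguments.
Unset Strict Implicit.
Unset Printing Implicit Defensive.

Import Order.TTheory GRing.Theory Num.Theory.
Import numFieldNormedType.Exports.

Local Open Scope classical_set_scope.
Local Open Scope ring_scope.

Section smooth.
Context {R : realType}.

(* Fréchet derivatives.  V is meant to be finite-dimensional, where continuity
   of a derivative with values in the linear maps amounts to continuity of its
   value on each vector. *)
Definition C1 {V : normedModType R} (f : V -> R) : Prop :=
  (forall p, differentiable f p) /\
  (forall v, continuous (fun p => 'd f p v)).

Definition C2 {V : normedModType R} (f : V -> R) : Prop :=
  (forall p, differentiable f p) /\
  (forall v, C1 (fun p => 'd f p v)).

Definition partial {m} (i : 'I_m) (phi : 'rV[R]_m -> R) : 'rV[R]_m -> R :=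
  fun y => 'D_(delta_mx 0 i) phi y.

Definition grad {m} (phi : 'rV[R]_m -> R) (y : 'rV[R]_m) : 'rV[R]_m :=
  \row_i partial i phi y.

Definition hessian {m} (phi : 'rV[R]_m -> R) (y : 'rV[R]_m) : 'M[R]_m :=
  \matrix_(i, j) partial i (partial j phi) y.

Definition morse {m} (phi : 'rV[R]_m -> R) : Prop :=
  C2 phi /\ forall y, grad phi y = 0 -> hessian phi y \in unitmx.

Definition piecewise_parametric_morse {n m}
    (h : 'rV[R]_n * 'rV[R]_m -> R) : Prop :=
  C2 h /\
  exists U : set 'rV[R]_n,
    [/\ open U, dense U & forall x, U x -> morse (fun y => h (x, y))].

Definition inner {m} (a y : 'rV[R]_m) : R := \sum_i a 0 i * y 0 i.

End smooth.

Section semialgebraic.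
Context {R : realType}.

Definition peval {k} (p : mpoly.mpoly k R) (x : 'rV[R]_k) : R :=
  mpoly.meval (fun i => x 0 i) p.

Definition basic_semialgebraic {k} (ps qs : seq (mpoly.mpoly k R))
    (x : 'rV[R]_k) : bool :=
  all (fun p => peval p x == 0) ps && all (fun q => 0 < peval q x) qs.

Definition semialgebraic {k} (A : set 'rV[R]_k) : Prop :=
  exists s : seq (seq (mpoly.mpoly k R) * seq (mpoly.mpoly k R)),
    A = [set x | has (fun c => basic_semialgebraic c.1 c.2 x) s].

Definition graph {n m} (g : 'rV[R]_n * 'rV[R]_m -> R) :
    set 'rV[R]_(n + m + 1) :=
  [set row_mx (row_mx z.1 z.2) (g z)%:M | z in [set: 'rV[R]_n * 'rV[R]_m]].

Definition semialgebraic_fun {n m} (g : 'rV[R]_n * 'rV[R]_m -> R) : Prop :=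
  semialgebraic (graph g).

End semialgebraic.

Definition residual {T : topologicalType} (A : set T) : Prop :=
  exists F : nat -> set T,
    (forall k, open (F k) /\ dense (F k)) /\ \bigcap_k F k `<=` A.

Section lebesgue.
Context {R : realType} {m : nat}.

Definition box (a b : 'rV[R]_m) : set 'rV[R]_m :=
  [set x | forall i, a 0 i <= x 0 i <= b 0 i].

Definition box_volume (a b : 'rV[R]_m) : R :=
  \prod_i Num.max 0 (b 0 i - a 0 i).

(* Lebesgue outer measure on R^m.  The covers are indexed by subsets D of nat,
   so that finite and empty covers are allowed: for m = 0 every box has
   volume 1. *)
Definition lebesgue_outer (A : set 'rV[R]_m) : \bar R :=
  ereal_inf [set v | exists (D : set nat) (a b : nat -> 'rV[R]_m),
    A `<=` \bigcup_(k in D) box (a k) (b k) /\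
    v = (\esum_(k in D) (box_volume (a k) (b k))%:E)%E].

Definition full_measure (A : set 'rV[R]_m) : Prop :=
  lebesgue_outer (~` A) = 0%E.

End lebesgue.

(* Main.v *)
(* Let S be the set of pairs (x, a) such that g(x, .) - <a, .> has a degenerate
   critical point.  It is semialgebraic by Tarski-Seidenberg, and for fixed x
   its fibre is the set of critical values of y |-> grad_y g(x, y), which
   contains no ball by Sard.  Hence S has empty interior.  A semialgebraic set
   with empty interior lies in the zero set of a nonzero polynomial: take the
   product of one nontrivial equation from each of its cells.  So S is included
   in {P = 0} for some P with P(x0, a0) <> 0, and whenever q(a) := P(x0, a) is
   nonzero, the polynomial P(., a) is nonzero, so that g - <a, .> is piecewise
   parametric Morse, the open dense set being {P(., a) <> 0}.  The exceptional
   set of vectors a is thus contained in {q = 0}, which is closed, nowhere dense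
   and null. *)
Require Import Defs.
From HB Require Import structures.
From mathcomp Require Import all_boot all_order all_algebra.
From mathcomp Require Import all_classical all_reals all_analysis.
From mathcomp Require Import zify ring lra.
From mathcomp Require Import (canonicals, coercions) mpoly.
From mathcomp Require qe_rcf ordered_qelim.

Set Implicit Arguments.
Unset Strict Implicit.
Unset Printing Implicit Defensive.

Import Order.TTheory GRing.Theory Num.Theory.
Import numFieldNormedType.Exports.

Local Open Scope classical_set_scope.
Local Open Scope ring_scope.

(** * Tarski-Seidenberg *)

(** Semialgebraicity of the set of vectors [a] does not come from [q]: the existence of an open
    dense set has to be expressed by a first-order formula. This is possible because the interior of
    the set of good [x] is the largest candidate, so that only its density has to be stated. Sard
    enters for the gradient of a C2 function, that is for a C1 map between spaces of equal
    dimension, and in the form that critical values contain no ball. On a bounded ball of [y] this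
    follows from counting grid points. The passage to all [y] is delicate, since an increasing union
    of sets without interior can have interior; it is made by treating the radius as one more
    variable of a semialgebraic set. The outer measure is defined by coverings with boxes, so the
    nullity of [{q = 0}] is obtained from explicit finite coverings of the bounded parts of
    [{|q| <= d}], by induction on the dimension. *)

Section polynomial_functions.
Context {R : realType}.

(** Generating polynomial functions inductively lets substitution, continuity and restriction to a
    line go by induction on the derivation; [polyfunP] ties the class to [mpoly]. *)
Inductive polyfun {k} : ('rV[R]_k -> R) -> Prop :=
| polyfun_cst c : polyfun (fun=> c)
| polyfun_coord i : polyfun (fun x => x 0 i)
| polyfun_add f g : polyfun f -> polyfun g -> polyfun (fun x => f x + g x)
| polyfun_mul f g : polyfun f -> polyfun g -> polyfun (fun x => f x * g x).

Lemma polyfun_opp {k} (f : 'rV[R]_k -> R) :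
  polyfun f -> polyfun (fun x => - f x).
Proof.
move=> pf; have -> : (fun x => - f x) = (fun x => -1 * f x).
  by apply/funext => x; rewrite mulN1r.
by apply: polyfun_mul => //; apply: polyfun_cst.
Qed.

Lemma polyfun_sub {k} (f g : 'rV[R]_k -> R) :
  polyfun f -> polyfun g -> polyfun (fun x => f x - g x).
Proof. by move=> pf pg; apply: polyfun_add => //; apply: polyfun_opp. Qed.

Lemma polyfun_sum {k} I (s : seq I) (P : pred I) (F : I -> 'rV[R]_k -> R) :
  (forall i, polyfun (F i)) -> polyfun (fun x => \sum_(i <- s | P i) F i x).
Proof.
move=> pF; elim: s => [|i s IHs].
  by under eq_fun do rewrite big_nil; apply: polyfun_cst.
under eq_fun do rewrite big_cons; case: (P i) => //.
exact: polyfun_add.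
Qed.

Lemma polyfun_prod {k} I (s : seq I) (P : pred I) (F : I -> 'rV[R]_k -> R) :
  (forall i, polyfun (F i)) -> polyfun (fun x => \prod_(i <- s | P i) F i x).
Proof.
move=> pF; elim: s => [|i s IHs].
  by under eq_fun do rewrite big_nil; apply: polyfun_cst.
under eq_fun do rewrite big_cons; case: (P i) => //.
exact: polyfun_mul.
Qed.

Lemma polyfun_exp {k} (f : 'rV[R]_k -> R) n :
  polyfun f -> polyfun (fun x => f x ^+ n).
Proof.
move=> pf; elim: n => [|n IHn]; first exact: polyfun_cst.
by under eq_fun do rewrite exprS; apply: polyfun_mul.
Qed.

Lemma polyfun_comp {k l} (f : 'rV[R]_k -> R) (F : 'rV[R]_l -> 'rV[R]_k) :
  polyfun f -> (forall i, polyfun (fun x => F x 0 i)) ->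
  polyfun (fun x => f (F x)).
Proof.
move=> pf pF; elim: pf => [c|i|g h _ pg _ ph|g h _ pg _ ph] //.
- exact: polyfun_cst.
- exact: polyfun_add.
- exact: polyfun_mul.
Qed.

Lemma polyfunP {k} (f : 'rV[R]_k -> R) :
  polyfun f <-> exists p : mpoly.mpoly k R, f = peval p.
Proof.
split=> [|[p ->]].
  elim=> [c|i|g h _ [p ->] _ [q ->]|g h _ [p ->] _ [q ->]].
  - by exists (mpoly.mpolyC k c); apply/funext => x; rewrite /peval mpoly.mevalC.
  - exists (mpoly.mpolyX R (mpoly.mnm1 i)).
    by apply/funext => x; rewrite /peval mpoly.mevalXU.
  - by exists (p + q); apply/funext => x; rewrite /peval mpoly.mevalD.
  - by exists (p * q); apply/funext => x; rewrite /peval mpoly.mevalM.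
rewrite (_ : peval p = fun x => \sum_(m <- mpoly.msupp p)
    mpoly.mcoeff m p * \prod_i x 0 i ^+ (m : mpoly.multinom k) i); last first.
  by apply/funext => x; rewrite /peval mpoly.mevalE.
apply: polyfun_sum => m; apply: polyfun_mul; first exact: polyfun_cst.
apply: polyfun_prod => i; apply: polyfun_exp; exact: polyfun_coord.
Qed.

Lemma polyfun_peval {k} (p : mpoly.mpoly k R) : polyfun (peval p).
Proof. by apply/polyfunP; exists p. Qed.

End polynomial_functions.

Section semialgebraic_sets.
Context {R : realType}.

Lemma semialgebraic_bool {k} (b : bool) : semialgebraic [set _ : 'rV[R]_k | b].
Proof. by case: b; [exists [:: ([::], [::])]|exists [::]]; rewrite predeqE. Qed.

Lemma semialgebraic_setU {k} (A B : set 'rV[R]_k) :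
  semialgebraic A -> semialgebraic B -> semialgebraic (A `|` B).
Proof.
move=> [s ->] [t ->]; exists (s ++ t); rewrite predeqE => x /=; rewrite has_cat.
by split => [[]->//|/orP[]]; rewrite ?orbT //; [left|right].
Qed.

Lemma semialgebraic_setI {k} (A B : set 'rV[R]_k) :
  semialgebraic A -> semialgebraic B -> semialgebraic (A `&` B).
Proof.
move=> [s ->] [t ->].
exists [seq (c.1 ++ d.1, c.2 ++ d.2) | c <- s, d <- t]; rewrite predeqE => x /=.
split=> [[/hasP[c cs cx] /hasP[d dt dx]]|/hasP[_ /allpairsP[[c d] /= [cs dt ->]]]].
  apply/hasP; exists (c.1 ++ d.1, c.2 ++ d.2).
    by apply/allpairsP; exists (c, d).
  move: cx dx; rewrite /basic_semialgebraic /= !all_cat.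
  by move=> /andP[-> ->] /andP[-> ->].
rewrite /basic_semialgebraic /= !all_cat.
move=> /andP[/andP[a1 a2] /andP[a3 a4]].
by split; apply/hasP; [exists c|exists d] => //; apply/andP.
Qed.

Lemma semialgebraic_eq0 {k} (f : 'rV[R]_k -> R) :
  polyfun f -> semialgebraic [set x | f x = 0].
Proof.
move=> /polyfunP[p ->]; exists [:: ([:: p], [::])]; rewrite predeqE => x /=.
rewrite orbF /basic_semialgebraic /= !andbT.
by split=> [->|/eqP].
Qed.

Lemma semialgebraic_gt0 {k} (f : 'rV[R]_k -> R) :
  polyfun f -> semialgebraic [set x | 0 < f x].
Proof.
move=> /polyfunP[p ->]; exists [:: ([::], [:: p])]; rewrite predeqE => x /=.
by rewrite orbF /basic_semialgebraic /= !andbT.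
Qed.

Lemma semialgebraic_neq0 {k} (f : 'rV[R]_k -> R) :
  polyfun f -> semialgebraic [set x | f x != 0].
Proof.
move=> pf; rewrite (_ : mkset _ = [set x | 0 < f x] `|` [set x | 0 < - f x]).
  by apply: semialgebraic_setU; apply: semialgebraic_gt0 => //;
    apply: polyfun_opp.
rewrite predeqE => x /=; rewrite oppr_gt0.
split; last by case; [move/gt_eqF->|move/lt_eqF->].
by case: (ltgtP (f x) 0) => // _ _; [right|left].
Qed.

Lemma semialgebraic_le0 {k} (f : 'rV[R]_k -> R) :
  polyfun f -> semialgebraic [set x | f x <= 0].
Proof.
move=> pf; rewrite (_ : mkset _ = [set x | 0 < - f x] `|` [set x | f x = 0]).
  apply: semialgebraic_setU; last exact: semialgebraic_eq0.
  by apply: semialgebraic_gt0; apply: polyfun_opp.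
rewrite predeqE => x /=; rewrite oppr_gt0.
split; last by case=> [/ltW//|->].
by rewrite le_eqVlt => /orP[/eqP|]; [right|left].
Qed.

(** Basic sets admit only equations and strict inequalities, so each negated condition is rewritten
    as a union of such sets; De Morgan and induction on the cells do the rest. *)
Lemma semialgebraic_setC {k} (A : set 'rV[R]_k) :
  semialgebraic A -> semialgebraic (~` A).
Proof.
move=> [s ->]; elim: s => [|c s IHs] /=.
  rewrite (_ : ~` _ = [set _ | true]); first exact: semialgebraic_bool.
  by rewrite predeqE.
rewrite (_ : ~` _ = [set x | ~~ basic_semialgebraic c.1 c.2 x] `&`
    ~` [set x | has (fun c => basic_semialgebraic c.1 c.2 x) s]).
  apply: semialgebraic_setI => //; case: c => ps qs /=.
  rewrite (_ : mkset _ = [set x | has (fun p => peval p x != 0) ps] `|`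
                 [set x | has (fun p => peval p x <= 0) qs]); last first.
    rewrite predeqE => x /=; rewrite /basic_semialgebraic negb_and -!has_predC.
    split=> [/orP[h|h]|[h|h]].
    + by left.
    + by right; apply: sub_has h => q /=; rewrite -leNgt.
    + by apply/orP; left.
    + by apply/orP; right; apply: sub_has h => q /=; rewrite -leNgt.
  apply: semialgebraic_setU.
    elim: ps => [|p ps IHps] /=; first exact: semialgebraic_bool.
    rewrite (_ : mkset _ = [set x | peval p x != 0] `|`
        [set x | has (fun p => peval p x != 0) ps]).
      by apply: semialgebraic_setU => //; apply/semialgebraic_neq0/polyfun_peval.
    by rewrite predeqE => x /=; split=> /orP.
  elim: qs => [|q qs IHqs] /=; first exact: semialgebraic_bool.
  rewrite (_ : mkset _ = [set x | peval q x <= 0] `|`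
      [set x | has (fun p => peval p x <= 0) qs]).
    by apply: semialgebraic_setU => //; apply/semialgebraic_le0/polyfun_peval.
  by rewrite predeqE => x /=; split=> /orP.
rewrite predeqE => x /=; split=> [/negP|[h1 /negP h2]]; last first.
  by apply/negP; rewrite negb_or h1.
by rewrite negb_or => /andP[h1 /negP h2].
Qed.

Lemma semialgebraic_preimage {k l} (A : set 'rV[R]_l)
    (F : 'rV[R]_k -> 'rV[R]_l) :
  (forall i, polyfun (fun x => F x 0 i)) -> semialgebraic A ->
  semialgebraic [set x | A (F x)].
Proof.
move=> pF [s ->]; elim: s => [|[ps qs] s IHs] /=; first exact: semialgebraic_bool.
rewrite (_ : mkset _ = [set x | basic_semialgebraic ps qs (F x)] `|`
    [set x | has (fun c => basic_semialgebraic c.1 c.2 (F x)) s]); last first.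
  by rewrite predeqE => x; split=> /orP.
apply: semialgebraic_setU => //.
rewrite (_ : mkset _ = [set x | all (fun p => peval p (F x) == 0) ps] `&`
   [set x | all (fun q => 0 < peval q (F x)) qs]); last first.
  by rewrite predeqE => x; split=> /andP.
have pc p : polyfun (fun x => peval p (F x)).
  by apply: polyfun_comp => //; apply: polyfun_peval.
apply: semialgebraic_setI.
  elim: ps => [|p ps IHps] /=.
    exact: semialgebraic_bool.
  rewrite (_ : mkset _ = [set x | peval p (F x) = 0] `&`
      [set x | all (fun p => peval p (F x) == 0) ps]).
    by apply: semialgebraic_setI => //; apply/semialgebraic_eq0.
  rewrite predeqE => x /=; split=> [/andP[/eqP]//|[-> ->]].
  by rewrite eqxx.
elim: qs => [|q qs IHqs] /=.
  exact: semialgebraic_bool.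
rewrite (_ : mkset _ = [set x | 0 < peval q (F x)] `&`
      [set x | all (fun p => 0 < peval p (F x)) qs]).
  by apply: semialgebraic_setI => //; apply/semialgebraic_gt0.
by rewrite predeqE => x /=; split=> /andP.
Qed.

End semialgebraic_sets.

(** * First-order formulas and quantifier elimination *)

Section first_order.
Context {R : realType}.
Import ordered_qelim.

Definition env {k} (x : 'rV[R]_k) : seq R := [seq x 0 i | i <- enum 'I_k].

Lemma size_env {k} (x : 'rV[R]_k) : size (env x) = k.
Proof. by rewrite size_map size_enum_ord. Qed.

Lemma nth_env {k} (x : 'rV[R]_k) (i : 'I_k) : nth 0 (env x) i = x 0 i.
Proof. by rewrite (nth_map i) ?size_enum_ord // nth_ord_enum. Qed.

Lemma env_row_mx {k l} (x : 'rV[R]_k) (y : 'rV[R]_l) :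
  env (row_mx x y) = env x ++ env y.
Proof.
apply: (@eq_from_nth _ 0); first by rewrite size_cat !size_env.
move=> i; rewrite size_env nth_cat size_env => lt_i.
have -> : nth 0 (env (row_mx x y)) i = row_mx x y 0 (Ordinal lt_i).
  by rewrite -nth_env.
case: (split_ordP (Ordinal lt_i)) => j Ej; rewrite Ej; move/(congr1 val): Ej => /= ->.
  by rewrite row_mxEl nth_env.
by rewrite row_mxEr addKn nth_env.
Qed.

Lemma envK {l} (s : seq R) : size s = l ->
  env (\row_(i < l) nth 0 s i) = s.
Proof.
move=> sl; apply: (@eq_from_nth _ 0); rewrite size_env // => i lt_i.
by rewrite -[i]/(val (Ordinal lt_i)) nth_env mxE.
Qed.

Lemma polyfun_eval {k} (t : GRing.term R) : GRing.rterm t ->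
  polyfun (fun x : 'rV[R]_k => GRing.eval (env x) t).
Proof.
elim: t => //=.
- move=> i _; case: (ltnP i k) => [lt_i|le_k].
    rewrite (_ : (fun _ => _) = fun x : 'rV[R]_k => x 0 (Ordinal lt_i)).
      exact: polyfun_coord.
    by apply/funext => x; rewrite -[i]/(val (Ordinal lt_i)) nth_env.
  (* A variable of index at least [k] reads the default value 0 of the list. *)
  rewrite (_ : (fun _ => _) = fun x : 'rV[R]_k => 0); first exact: polyfun_cst.
  by apply/funext => x; rewrite nth_default // size_env.
- by move=> c _; apply: polyfun_cst.
- by move=> c _; apply: polyfun_cst.
- by move=> t IHt u IHu /andP[/IHt pt /IHu pu]; apply: polyfun_add.
- by move=> t IHt /IHt; apply: polyfun_opp.
- move=> t IHt n /IHt pt; under eq_fun do rewrite -mulr_natr.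
  by apply: polyfun_mul => //; apply: polyfun_cst.
- by move=> t IHt u IHu /andP[/IHt pt /IHu pu]; apply: polyfun_mul.
- by move=> t IHt n /IHt; apply: polyfun_exp.
Qed.

Lemma polyfun_term {k} (f : 'rV[R]_k -> R) : polyfun f ->
  exists t : GRing.term R, forall x, f x = GRing.eval (env x) t.
Proof.
elim=> [c|i|g h _ [t tE] _ [u uE]|g h _ [t tE] _ [u uE]].
- by exists (GRing.Const c).
- by exists (GRing.Var R i) => x /=; rewrite nth_env.
- by exists (GRing.Add t u) => x; rewrite tE uE.
- by exists (GRing.Mul t u) => x; rewrite tE uE.
Qed.

Definition formula_definable {k} (A : set 'rV[R]_k) :=
  exists f : ord.formula R, forall x, A x <-> ord.holds (env x) f.

Lemma semialgebraic_definable {k} (A : set 'rV[R]_k) :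
  semialgebraic A -> formula_definable A.
Proof.
have defI B C : formula_definable B -> formula_definable C ->
    formula_definable (B `&` C).
  by move=> [f fB] [f' fC]; exists (ord.And f f') => x /=; rewrite -fB -fC.
have def_all T (P : T -> set 'rV[R]_k) (s : seq T) :
    (forall t, formula_definable (P t)) ->
    formula_definable [set x | all (fun t => `[< P t x >]) s].
  move=> dP; elim: s => [|t s IHs] /=; first by exists (ord.Bool true).
  rewrite (_ : mkset _ = P t `&` [set x | all (fun t => `[< P t x >]) s]).
    exact: defI.
  by rewrite predeqE => x /=; split=> [/andP[/asboolP]//|[/asboolP-> ->]].
move=> [s ->]; elim: s => [|[ps qs] s [f IHs]] /=.
  by exists (ord.Bool false).
suff [f' f'P] : formula_definable [set x | basic_semialgebraic ps qs x].
  exists (ord.Or f' f) => x /=; rewrite -IHs -f'P.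
  by split=> /orP.
rewrite (_ : mkset _ =
   [set x | all (fun p => `[< [set x | peval p x = 0] x >]) ps] `&`
   [set x | all (fun p => `[< [set x | 0 < peval p x] x >]) qs]); last first.
  rewrite predeqE => x /=; rewrite /basic_semialgebraic.
  rewrite -(rwP andP) (eq_all (a2 := fun p => `[< peval p x = 0 >])); last first.
    by move=> p; apply/eqP/asboolP.
  rewrite (@eq_all _ (fun q => 0 < peval q x) (fun q => `[< 0 < peval q x >])) //.
  by move=> p; rewrite asboolb.
apply: defI; apply: def_all => p;
  have [t tE] := polyfun_term (polyfun_peval p).
  by exists (ord.Equal t (GRing.Const 0)) => x /=; rewrite tE.
by exists (ord.Lt (GRing.Const 0) t) => x /=; rewrite tE.
Qed.

(** Quantifier elimination over a real closed field yields an equivalent quantifier-free [h]. Its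
    terms contain no inverse ([rformula]), so its atoms are polynomial conditions, and the
    connectives follow from Boolean closure. *)
Lemma definable_semialgebraic {k} (A : set 'rV[R]_k) :
  formula_definable A -> semialgebraic A.
Proof.
move=> [f fA].
pose h := ord.quantifier_elim
  (fun i s => qe_rcf.qfr_to_formula (@qe_rcf.wproj R i s)) (ord.to_rform f).
have /andP[qfh rfh] : ord.qf_form h && ord.rformula h.
  by apply: (ord.quantifier_elim_wf (@qe_rcf.wf_QE_wproj R));
     apply: ord.to_rform_rformula.
have -> : A = [set x | ord.qf_eval (env x) h].
  by rewrite predeqE => x; rewrite fA; split=> [/(qe_rcf.rcf_satP (env x) f)|
     h_x]; [|apply/(qe_rcf.rcf_satP (env x) f)].
elim: {f fA} h qfh rfh => //=.
- by move=> b _ _; apply: semialgebraic_bool.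
- move=> t u _ /andP[rt ru]; rewrite (_ : mkset _ = [set x : 'rV[R]_k |
      GRing.eval (env x) t - GRing.eval (env x) u = 0]).
    by apply/semialgebraic_eq0/polyfun_sub; apply: polyfun_eval.
  rewrite predeqE => x /=.
  by split=> [/eqP->|/eqP]; rewrite ?subrr // subr_eq0.
- move=> t u _ /andP[rt ru]; rewrite (_ : mkset _ = [set x : 'rV[R]_k |
      0 < GRing.eval (env x) u - GRing.eval (env x) t]).
    by apply/semialgebraic_gt0/polyfun_sub; apply: polyfun_eval.
  by rewrite predeqE => x /=; rewrite subr_gt0.
- move=> t u _ /andP[rt ru]; rewrite (_ : mkset _ = [set x : 'rV[R]_k |
      GRing.eval (env x) t - GRing.eval (env x) u <= 0]).
    by apply/semialgebraic_le0/polyfun_sub; apply: polyfun_eval.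
  by rewrite predeqE => x /=; rewrite subr_le0.
- move=> f1 IH1 f2 IH2 /andP[/IH1{}IH1 /IH2{}IH2] /andP[/IH1 s1 /IH2 s2].
  have := semialgebraic_setI s1 s2; congr semialgebraic.
  by rewrite predeqE => x /=; split=> /andP.
- move=> f1 IH1 f2 IH2 /andP[/IH1{}IH1 /IH2{}IH2] /andP[/IH1 s1 /IH2 s2].
  have := semialgebraic_setU s1 s2; congr semialgebraic.
  by rewrite predeqE => x /=; split=> /orP.
- move=> f1 IH1 f2 IH2 /andP[/IH1{}IH1 /IH2{}IH2] /andP[/IH1 s1 /IH2 s2].
  have := semialgebraic_setU (semialgebraic_setC s1) s2; congr semialgebraic.
  rewrite predeqE => x /=; case: (ord.qf_eval (env x) f1) => /=.
    by split=> [[]//|]; right.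
  by split=> // _; left.
- move=> f1 IH1 /IH1{}IH1 /IH1 s1.
  have := semialgebraic_setC s1; congr semialgebraic.
  by rewrite predeqE => x /=; split=> /negP.
Qed.

(** Variables are positional: binding index [size e] appends a value to the valuation, so a block of
    [l] quantifiers starting there ranges over the tails of length [l]. *)
Lemma holds_Exists (f : ord.formula R) l e :
  ord.holds e (foldr (@ord.Exists R) f (iota (size e) l)) <->
  exists s, size s = l /\ ord.holds (e ++ s) f.
Proof.
elim: l e => [|l IHl] e /=.
  split=> [fe|[s [/size0nil->]]]; last by rewrite cats0.
  by exists [::]; rewrite cats0.
split=> [[x]|[[|x s] [//= [sz_s] fs]]].
  rewrite (_ : set_nth 0 e (size e) x = rcons e x); last first.
    by elim: (e) => //= y e' ->.
  rewrite -(size_rcons e x) IHl => -[s [sz_s]].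
  by rewrite cat_rcons => fs; exists (x :: s); rewrite /= sz_s.
exists x; rewrite (_ : set_nth 0 e (size e) x = rcons e x); last first.
  by elim: (e) => //= y e' ->.
by rewrite -(size_rcons e x) IHl; exists s; rewrite cat_rcons.
Qed.

Lemma semialgebraic_proj {k l} (A : set 'rV[R]_(k + l)) :
  semialgebraic A -> semialgebraic [set x | exists y, A (row_mx x y)].
Proof.
move=> /semialgebraic_definable[f fA]; apply: definable_semialgebraic.
exists (foldr (@ord.Exists R) f (iota k l)) => x /=.
have := holds_Exists f l (env x); rewrite size_env => ->; split=> [[y /fA]|[s [sz_s fs]]].
  by rewrite env_row_mx => fy; exists (env y); rewrite size_env.
by exists (\row_(i < l) nth 0 s i); apply/fA; rewrite env_row_mx envK.
Qed.

End first_order.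

(** * Semialgebraic maps *)

Section semialgebraic_maps.
Context {R : realType}.

Definition polymap {k l} (F : 'rV[R]_k -> 'rV[R]_l) :=
  forall i, polyfun (fun x => F x 0 i).

Lemma polymap_id {k} : polymap (@id 'rV[R]_k).
Proof. by move=> i; apply: polyfun_coord. Qed.

Lemma polymap_lsubmx {k l p} (F : 'rV[R]_k -> 'rV[R]_(l + p)) :
  polymap F -> polymap (fun x => lsubmx (F x)).
Proof. by move=> pF i; under eq_fun do rewrite mxE; apply: pF. Qed.

Lemma polymap_rsubmx {k l p} (F : 'rV[R]_k -> 'rV[R]_(l + p)) :
  polymap F -> polymap (fun x => rsubmx (F x)).
Proof. by move=> pF i; under eq_fun do rewrite mxE; apply: pF. Qed.

Lemma polymap_row_mx {k l p} (F : 'rV[R]_k -> 'rV[R]_l)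
    (G : 'rV[R]_k -> 'rV[R]_p) :
  polymap F -> polymap G -> polymap (fun x => row_mx (F x) (G x)).
Proof.
move=> pF pG i; case: (split_ordP i) => j ->.
  by under eq_fun do rewrite row_mxEl; apply: pF.
by under eq_fun do rewrite row_mxEr; apply: pG.
Qed.

Lemma polymap_const_mx {k l} (f : 'rV[R]_k -> R) :
  polyfun f -> polymap (fun x => const_mx (f x) : 'rV[R]_l).
Proof. by move=> pf i; under eq_fun do rewrite mxE. Qed.

Lemma semialgebraic_and {k} (P Q : 'rV[R]_k -> Prop) :
  semialgebraic [set x | P x] -> semialgebraic [set x | Q x] ->
  semialgebraic [set x | P x /\ Q x].
Proof. exact: semialgebraic_setI. Qed.

Lemma semialgebraic_not {k} (P : 'rV[R]_k -> Prop) :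
  semialgebraic [set x | P x] -> semialgebraic [set x | ~ P x].
Proof. exact: semialgebraic_setC. Qed.

Lemma semialgebraic_imply {k} (P Q : 'rV[R]_k -> Prop) :
  semialgebraic [set x | P x] -> semialgebraic [set x | Q x] ->
  semialgebraic [set x | P x -> Q x].
Proof.
move=> /semialgebraic_setC sP sQ.
have := semialgebraic_setU sP sQ; congr semialgebraic.
rewrite predeqE => x /=; split=> [[//|//]|PQ].
by case: (pselect (P x)) => [/PQ|]; [right|left].
Qed.

Lemma semialgebraic_forall_fin {k} (I : finType) (P : I -> 'rV[R]_k -> Prop) :
  (forall i, semialgebraic [set x | P i x]) ->
  semialgebraic [set x | forall i, P i x].
Proof.
move=> sP; rewrite (_ : mkset _ = [set x | forall i, i \in enum I -> P i x]).
  elim: (enum I) => [|i s IHs].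
    have := @semialgebraic_bool R k true; congr semialgebraic.
    by rewrite predeqE.
  have := semialgebraic_setI (sP i) IHs; congr semialgebraic.
  rewrite predeqE => x /=; split=> [[Pi Ps] j|Ps].
    by rewrite inE => /orP[/eqP->//|]; apply: Ps.
  by split=> [|j js]; apply: Ps; rewrite inE ?eqxx ?js ?orbT.
by rewrite predeqE => x /=; split=> // Px i; apply: Px; rewrite mem_enum.
Qed.

Lemma semialgebraic_exists {k l} (P : 'rV[R]_k -> 'rV[R]_l -> Prop) :
  semialgebraic [set z : 'rV_(k + l) | P (lsubmx z) (rsubmx z)] ->
  semialgebraic [set x | exists y, P x y].
Proof.
move=> /semialgebraic_proj; congr semialgebraic; rewrite predeqE => x /=.
by split=> -[y]; [|exists y]; rewrite ?row_mxKl ?row_mxKr => //; exists y.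
Qed.

Lemma semialgebraic_forall {k l} (P : 'rV[R]_k -> 'rV[R]_l -> Prop) :
  semialgebraic [set z : 'rV_(k + l) | P (lsubmx z) (rsubmx z)] ->
  semialgebraic [set x | forall y, P x y].
Proof.
move=> /semialgebraic_not/(semialgebraic_exists (P := fun x y => ~ P x y)).
move=> /semialgebraic_not.
congr semialgebraic; rewrite predeqE => x /=.
by split=> [nP y|P_x [y /(_ (P_x y))//]]; apply: contrapT => nPy; apply: nP; exists y.
Qed.

Lemma semialgebraic_existsR {k} (P : 'rV[R]_k -> R -> Prop) :
  semialgebraic [set z : 'rV_(k + 1) | P (lsubmx z) (rsubmx z 0 0)] ->
  semialgebraic [set x | exists r, P x r].
Proof.
move=> /(semialgebraic_exists (P := fun x y => P x (y 0 0))).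
congr semialgebraic; rewrite predeqE => x /=.
split=> [[y]|[r Pr]]; first by exists (y 0 0).
by exists (const_mx r); rewrite mxE.
Qed.

Lemma semialgebraic_forallR {k} (P : 'rV[R]_k -> R -> Prop) :
  semialgebraic [set z : 'rV_(k + 1) | P (lsubmx z) (rsubmx z 0 0)] ->
  semialgebraic [set x | forall r, P x r].
Proof.
move=> /(semialgebraic_forall (P := fun x y => P x (y 0 0))).
congr semialgebraic; rewrite predeqE => x /=.
split=> [h r|h y]; last exact: h.
by have := h (const_mx r); rewrite mxE.
Qed.

Definition semialgebraic_map {k l} (F : 'rV[R]_k -> 'rV[R]_l) :=
  semialgebraic [set z : 'rV_(k + l) | rsubmx z = F (lsubmx z)].

Definition semialgebraic_scalar {k} (t : 'rV[R]_k -> R) :=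
  semialgebraic [set z : 'rV_(k + 1) | rsubmx z 0 0 = t (lsubmx z)].

(** The condition reads [exists y, P y /\ y = F x], so substituting a semialgebraic map amounts to a
    projection and rests on Tarski-Seidenberg. *)
Lemma semialgebraic_comp {k l} (P : 'rV[R]_l -> Prop)
    (F : 'rV[R]_k -> 'rV[R]_l) :
  semialgebraic_map F -> semialgebraic [set y | P y] ->
  semialgebraic [set x | P (F x)].
Proof.
move=> sF sP; have := @semialgebraic_exists k l
  (fun x y => P y /\ y = F x).
have pr : polymap (fun z : 'rV[R]_(k + l) => rsubmx z).
  exact/polymap_rsubmx/polymap_id.
move=> /(_ (semialgebraic_and (semialgebraic_preimage pr sP) sF)).
congr semialgebraic; rewrite predeqE => x /=.
by split=> [[y [Py <-//]]|]; exists (F x).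
Qed.

Lemma semialgebraic_scalar_poly {k} (t : 'rV[R]_k -> R) :
  polyfun t -> semialgebraic_scalar t.
Proof.
move=> pt; have := @semialgebraic_eq0 R (k + 1)
  (fun z => rsubmx z 0 0 - t (lsubmx z)).
rewrite /semialgebraic_scalar.
move=> /(_ (polyfun_sub _ _)).
have pl : polymap (fun z : 'rV[R]_(k + 1) => lsubmx z).
  exact/polymap_lsubmx/polymap_id.
have pr : polymap (fun z : 'rV[R]_(k + 1) => rsubmx z).
  exact/polymap_rsubmx/polymap_id.
move=> /(_ (pr 0) (polyfun_comp pt pl)); congr semialgebraic.
by rewrite predeqE => z /=; split=> [/eqP|->]; rewrite ?subrr // subr_eq0 => /eqP.
Qed.

Lemma semialgebraic_scalar_comp {k l} (t : 'rV[R]_l -> R)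
    (F : 'rV[R]_k -> 'rV[R]_l) :
  semialgebraic_map F -> semialgebraic_scalar t ->
  semialgebraic_scalar (fun x => t (F x)).
Proof.
move=> sF st; rewrite /semialgebraic_scalar.
have pl : polymap (fun z : 'rV[R]_(k + 1 + l) => lsubmx z).
  exact/polymap_lsubmx/polymap_id.
have pr : polymap (fun z : 'rV[R]_(k + 1 + l) => rsubmx z).
  exact/polymap_rsubmx/polymap_id.
have := @semialgebraic_exists (k + 1) l
  (fun z v => v = F (lsubmx z) /\ rsubmx z 0 0 = t v).
have sF' : semialgebraic [set z : 'rV_(k + 1 + l) |
    rsubmx z = F (lsubmx (lsubmx z))].
  have := semialgebraic_preimage (polymap_row_mx (polymap_lsubmx pl) pr) sF.
  by congr semialgebraic; rewrite predeqE => z /=; rewrite row_mxKl row_mxKr.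
have st' : semialgebraic [set z : 'rV_(k + 1 + l) |
    rsubmx (lsubmx z) 0 0 = t (rsubmx z)].
  have := semialgebraic_preimage (polymap_row_mx pr (polymap_rsubmx pl)) st.
  by congr semialgebraic; rewrite predeqE => z /=; rewrite row_mxKl row_mxKr.
move=> /(_ (semialgebraic_and sF' st')).
congr semialgebraic; rewrite predeqE => x /=.
by split=> [[y [-> ->//]]|]; exists (F (lsubmx x)).
Qed.

Lemma semialgebraic_map_coord {k l} (F : 'rV[R]_k -> 'rV[R]_l) :
  (forall i, semialgebraic_scalar (fun x => F x 0 i)) -> semialgebraic_map F.
Proof.
move=> sF; have pl : polymap (fun z : 'rV[R]_(k + l) => lsubmx z).
  exact/polymap_lsubmx/polymap_id.
have pr : polymap (fun z : 'rV[R]_(k + l) => rsubmx z).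
  exact/polymap_rsubmx/polymap_id.
have : semialgebraic [set z : 'rV[R]_(k + l) |
    forall i, rsubmx z 0 i = F (lsubmx z) 0 i].
  apply: semialgebraic_forall_fin => i.
  have := semialgebraic_preimage
    (polymap_row_mx pl (polymap_const_mx (l := 1) (pr i))) (sF i).
  by congr semialgebraic; rewrite predeqE => z /=;
    rewrite row_mxKl row_mxKr [const_mx _ _ _]mxE.
congr semialgebraic; rewrite predeqE => z /=; split=> [h|->//].
by apply/rowP.
Qed.

Lemma semialgebraic_scalar_coord {k l} (F : 'rV[R]_k -> 'rV[R]_l) i :
  semialgebraic_map F -> semialgebraic_scalar (fun x => F x 0 i).
Proof.
move=> sF; apply: (semialgebraic_scalar_comp (t := fun y => y 0 i)) => //.
exact/semialgebraic_scalar_poly/polyfun_coord.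
Qed.

Lemma semialgebraic_map_poly {k l} (F : 'rV[R]_k -> 'rV[R]_l) :
  polymap F -> semialgebraic_map F.
Proof.
by move=> pF; apply: semialgebraic_map_coord => i; apply: semialgebraic_scalar_poly.
Qed.

Lemma semialgebraic_map_row_mx {k l p} (F : 'rV[R]_k -> 'rV[R]_l)
    (G : 'rV[R]_k -> 'rV[R]_p) :
  semialgebraic_map F -> semialgebraic_map G ->
  semialgebraic_map (fun x => row_mx (F x) (G x)).
Proof.
move=> sF sG; apply: semialgebraic_map_coord => i; case: (split_ordP i) => j ->.
  by under eq_fun do rewrite row_mxEl; apply: semialgebraic_scalar_coord.
by under eq_fun do rewrite row_mxEr; apply: semialgebraic_scalar_coord.
Qed.

Lemma semialgebraic_map_lsubmx {k l p} (F : 'rV[R]_k -> 'rV[R]_(l + p)) :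
  semialgebraic_map F -> semialgebraic_map (fun x => lsubmx (F x)).
Proof.
move=> sF; apply: semialgebraic_map_coord => i.
by under eq_fun do rewrite mxE; apply: semialgebraic_scalar_coord.
Qed.

Lemma semialgebraic_map_rsubmx {k l p} (F : 'rV[R]_k -> 'rV[R]_(l + p)) :
  semialgebraic_map F -> semialgebraic_map (fun x => rsubmx (F x)).
Proof.
move=> sF; apply: semialgebraic_map_coord => i.
by under eq_fun do rewrite mxE; apply: semialgebraic_scalar_coord.
Qed.

Lemma semialgebraic_map_const_mx {k l} (t : 'rV[R]_k -> R) :
  semialgebraic_scalar t ->
  semialgebraic_map (fun x => const_mx (t x) : 'rV_l).
Proof.
move=> st; apply: semialgebraic_map_coord => i.
by under eq_fun do rewrite mxE.
Qed.

(** Composing with this pair reduces binary operations and comparisons of scalars to polynomial ones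
    on the plane. *)
Lemma semialgebraic_map_pair {k} (t u : 'rV[R]_k -> R) :
  semialgebraic_scalar t -> semialgebraic_scalar u ->
  semialgebraic_map (fun x => row_mx (const_mx (t x)) (const_mx (u x)) : 'rV_(1 + 1)).
Proof.
by move=> st su; apply: semialgebraic_map_row_mx; apply: semialgebraic_map_const_mx.
Qed.

Lemma semialgebraic_scalar_add {k} (t u : 'rV[R]_k -> R) :
  semialgebraic_scalar t -> semialgebraic_scalar u ->
  semialgebraic_scalar (fun x => t x + u x).
Proof.
move=> st su; have := semialgebraic_scalar_comp (semialgebraic_map_pair st su)
  (semialgebraic_scalar_poly (polyfun_add (polyfun_coord (lshift 1 0))
                                          (polyfun_coord (rshift 1 0)))).
by congr semialgebraic_scalar; apply/funext => x; rewrite row_mxEl row_mxEr !mxE.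
Qed.

Lemma semialgebraic_scalar_mul {k} (t u : 'rV[R]_k -> R) :
  semialgebraic_scalar t -> semialgebraic_scalar u ->
  semialgebraic_scalar (fun x => t x * u x).
Proof.
move=> st su; have := semialgebraic_scalar_comp (semialgebraic_map_pair st su)
  (semialgebraic_scalar_poly (polyfun_mul (polyfun_coord (lshift 1 0))
                                          (polyfun_coord (rshift 1 0)))).
by congr semialgebraic_scalar; apply/funext => x; rewrite row_mxEl row_mxEr !mxE.
Qed.

Lemma semialgebraic_scalar_cst {k} (c : R) :
  semialgebraic_scalar (fun _ : 'rV[R]_k => c).
Proof. exact/semialgebraic_scalar_poly/polyfun_cst. Qed.

Lemma semialgebraic_scalar_opp {k} (t : 'rV[R]_k -> R) :
  semialgebraic_scalar t -> semialgebraic_scalar (fun x => - t x).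
Proof.
move=> st; under eq_fun do rewrite -mulN1r.
exact: (semialgebraic_scalar_mul (semialgebraic_scalar_cst _)).
Qed.

Lemma semialgebraic_scalar_exp {k} (t : 'rV[R]_k -> R) n :
  semialgebraic_scalar t -> semialgebraic_scalar (fun x => t x ^+ n).
Proof.
move=> st; elim: n => [|n IHn]; first exact: semialgebraic_scalar_cst.
by under eq_fun do rewrite exprS; apply: semialgebraic_scalar_mul.
Qed.

Lemma semialgebraic_scalar_sum {k} I (s : seq I) (t : I -> 'rV[R]_k -> R) :
  (forall i, semialgebraic_scalar (t i)) ->
  semialgebraic_scalar (fun x => \sum_(i <- s) t i x).
Proof.
move=> st; elim: s => [|i s IHs].
  by under eq_fun do rewrite big_nil; apply: semialgebraic_scalar_cst.
by under eq_fun do rewrite big_cons; apply: semialgebraic_scalar_add.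
Qed.

Lemma semialgebraic_scalar_prod {k} I (s : seq I) (t : I -> 'rV[R]_k -> R) :
  (forall i, semialgebraic_scalar (t i)) ->
  semialgebraic_scalar (fun x => \prod_(i <- s) t i x).
Proof.
move=> st; elim: s => [|i s IHs].
  by under eq_fun do rewrite big_nil; apply: semialgebraic_scalar_cst.
by under eq_fun do rewrite big_cons; apply: semialgebraic_scalar_mul.
Qed.

Lemma semialgebraic_map_add {k l} (F G : 'rV[R]_k -> 'rV[R]_l) :
  semialgebraic_map F -> semialgebraic_map G ->
  semialgebraic_map (fun x => F x + G x).
Proof.
move=> sF sG; apply: semialgebraic_map_coord => i.
under eq_fun do rewrite mxE.
by apply: semialgebraic_scalar_add; apply: semialgebraic_scalar_coord.
Qed.

Lemma semialgebraic_map_scale {k l} (t : 'rV[R]_k -> R) (v : 'rV[R]_l) :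
  semialgebraic_scalar t -> semialgebraic_map (fun x => t x *: v).
Proof.
move=> st; apply: semialgebraic_map_coord => i.
under eq_fun do rewrite mxE.
exact: (semialgebraic_scalar_mul st (semialgebraic_scalar_cst _)).
Qed.

Lemma semialgebraic_eq {k} (t u : 'rV[R]_k -> R) :
  semialgebraic_scalar t -> semialgebraic_scalar u ->
  semialgebraic [set x | t x = u x].
Proof.
move=> st su; have := semialgebraic_comp (semialgebraic_map_pair st su)
  (semialgebraic_eq0 (polyfun_sub (polyfun_coord (lshift 1 0))
                                  (polyfun_coord (rshift 1 0)))).
congr semialgebraic; rewrite predeqE => x /=; rewrite row_mxEl row_mxEr !mxE.
by split=> [/eqP|->]; rewrite ?subrr // subr_eq0 => /eqP.
Qed.

Lemma semialgebraic_lt {k} (t u : 'rV[R]_k -> R) :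
  semialgebraic_scalar t -> semialgebraic_scalar u ->
  semialgebraic [set x | t x < u x].
Proof.
move=> st su; have := semialgebraic_comp (semialgebraic_map_pair st su)
  (semialgebraic_gt0 (polyfun_sub (polyfun_coord (rshift 1 0))
                                  (polyfun_coord (lshift 1 0)))).
congr semialgebraic; rewrite predeqE => x /=; rewrite row_mxEl row_mxEr !mxE.
by rewrite subr_gt0.
Qed.

Lemma semialgebraic_le {k} (t u : 'rV[R]_k -> R) :
  semialgebraic_scalar t -> semialgebraic_scalar u ->
  semialgebraic [set x | t x <= u x].
Proof.
move=> st su; have := semialgebraic_not (semialgebraic_lt su st).
by congr semialgebraic; rewrite predeqE => x /=; rewrite leNgt; split=> /negP.
Qed.

(* Squares replace absolute values, so that the limit defining the derivative is
   stated by a first-order formula over polynomials in [t] and [d]. *)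
Lemma semialgebraic_derivative {k} (t d : 'rV[R]_k -> R) (v : 'rV[R]_k) :
  semialgebraic_scalar t ->
  (forall x (e : R), 0 < e -> exists c : R, 0 < c /\ forall h : R, h != 0 ->
     h ^+ 2 < c -> (t (x + h *: v) - t x - d x * h) ^+ 2 <= e * h ^+ 2) ->
  semialgebraic_scalar d.
Proof.
move=> st td.
have : semialgebraic [set z : 'rV_(k + 1) | forall e : R, 0 < e ->
    exists c : R, 0 < c /\ forall h : R, ~ h = 0 -> h ^+ 2 < c ->
     (t (lsubmx z + h *: v) - t (lsubmx z) - rsubmx z 0 0 * h) ^+ 2 <= e * h ^+ 2].
  have pid p : semialgebraic_map (@id 'rV[R]_p).
    exact: semialgebraic_map_poly polymap_id.
  apply: semialgebraic_forallR; apply: semialgebraic_imply.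
    apply: semialgebraic_lt; first exact: semialgebraic_scalar_cst.
    exact/semialgebraic_scalar_coord/semialgebraic_map_rsubmx.
  apply: semialgebraic_existsR; apply: semialgebraic_and.
    apply: semialgebraic_lt; first exact: semialgebraic_scalar_cst.
    exact/semialgebraic_scalar_coord/semialgebraic_map_rsubmx.
  apply: semialgebraic_forallR.
  (* The four trailing coordinates are, from left to right, the candidate derivative [w], then [e],
     [c] and [h]. *)
  have sh : semialgebraic_scalar
      (fun z : 'rV[R]_(k + 1 + 1 + 1 + 1) => rsubmx z 0 0).
    exact/semialgebraic_scalar_coord/semialgebraic_map_rsubmx.
  have sc : semialgebraic_scalar
      (fun z : 'rV[R]_(k + 1 + 1 + 1 + 1) => rsubmx (lsubmx z) 0 0).
    apply: (semialgebraic_scalar_coord (F := fun z => rsubmx (lsubmx z))).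
    apply: (semialgebraic_map_rsubmx (F := fun z => lsubmx z)).
    exact: semialgebraic_map_lsubmx.
  have se : semialgebraic_scalar
      (fun z : 'rV[R]_(k + 1 + 1 + 1 + 1) => rsubmx (lsubmx (lsubmx z)) 0 0).
    apply: (semialgebraic_scalar_coord (F := fun z => rsubmx (lsubmx (lsubmx z)))).
    apply: (semialgebraic_map_rsubmx (F := fun z => lsubmx (lsubmx z))).
    apply: (semialgebraic_map_lsubmx (F := fun z => lsubmx z)).
    exact: semialgebraic_map_lsubmx.
  have sz : semialgebraic_map
      (fun z : 'rV[R]_(k + 1 + 1 + 1 + 1) => lsubmx (lsubmx (lsubmx z))).
    by do 3!apply: semialgebraic_map_lsubmx.
  apply: semialgebraic_imply.
    apply: semialgebraic_not; apply: semialgebraic_eq => //.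
    exact: semialgebraic_scalar_cst.
  apply: semialgebraic_imply.
    by apply: semialgebraic_lt => //; apply: semialgebraic_scalar_exp.
  apply: semialgebraic_le; last first.
    by apply: semialgebraic_scalar_mul => //; apply: semialgebraic_scalar_exp.
  apply: semialgebraic_scalar_exp; apply: semialgebraic_scalar_add; last first.
    apply/semialgebraic_scalar_opp/semialgebraic_scalar_mul => //.
    exact/semialgebraic_scalar_coord/semialgebraic_map_rsubmx.
  apply: semialgebraic_scalar_add.
    apply: (semialgebraic_scalar_comp (t := t)) => //.
    apply: semialgebraic_map_add; first exact: semialgebraic_map_lsubmx.
    exact: semialgebraic_map_scale.
  apply/semialgebraic_scalar_opp.
  apply: (semialgebraic_scalar_comp (t := t)) => //.
  exact: semialgebraic_map_lsubmx.
congr semialgebraic; rewrite predeqE => z /=.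
set x := lsubmx z; set w := rsubmx z 0 0; split=> [h|-> e /(td x)[c [c0 cP]]].
  apply/eqP; rewrite -subr_eq0 -sqrf_eq0 eq_le sqr_ge0 andbT.
  apply/ler_addgt0Pr => e e0; rewrite add0r.
  (* Uniqueness of the derivative: [(w - d x) ^ 2 * r ^ 2] is at most twice the sum of the two
     squared errors, each bounded by [e / 4 * r ^ 2]. *)
  have e4 : 0 < e / 4%:R by rewrite divr_gt0 // ltr0n.
  have [c [c0 cP]] := h _ e4; have [c' [c'0 cP']] := td x _ e4.
  (* The cap at 1 makes [(m / 2) ^ 2 < m], so that a single increment [r] is admissible for both [c]
     and [c']. *)
  pose m := Num.min (Num.min c c') 1.
  have m0 : 0 < m by rewrite !lt_min c0 c'0 ltr01.
  pose r := m / 2%:R; have r0 : 0 < r by rewrite divr_gt0 // ltr0n.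
  have rm : r ^+ 2 < m.
    have m1 : m <= 1 by rewrite ge_min lexx orbT.
    by rewrite /r; nra.
  have rc : r ^+ 2 < c.
    by apply: (lt_le_trans rm); rewrite /m !ge_min lexx.
  have rc' : r ^+ 2 < c'.
    by apply: (lt_le_trans rm); rewrite /m !ge_min lexx orbT.
  have rn0 : ~ r = 0 by apply/eqP; rewrite gt_eqF.
  have := cP _ rn0 rc; have := cP' r; rewrite gt_eqF // => /(_ isT rc').
  set D := t _ - t _; set y := d x => h1 h2.
  have r2 : 0 < r ^+ 2 by rewrite exprn_gt0.
  rewrite -(ler_pM2r r2).
  have h3 : 0 <= ((D - w * r) + (D - y * r)) ^+ 2 by apply: sqr_ge0.
  have -> : (w - y) ^+ 2 * r ^+ 2 = 2 * (D - w * r) ^+ 2 + 2 * (D - y * r) ^+ 2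
     - ((D - w * r) + (D - y * r)) ^+ 2 by ring.
  by lra.
by exists c; split=> // r /eqP rn0; apply: cP.
Qed.

Lemma semialgebraic_fun_scalar {n m} (g : 'rV[R]_n * 'rV[R]_m -> R) :
  semialgebraic_fun g ->
  semialgebraic_scalar (fun z : 'rV[R]_(n + m) => g (lsubmx z, rsubmx z)).
Proof.
congr semialgebraic; rewrite predeqE => z /=; split=> [[[x y] _ /= <-]|zE].
  by rewrite !row_mxKr !row_mxKl mxE eqxx mulr1n row_mxKr.
exists (lsubmx (lsubmx z), rsubmx (lsubmx z)) => //=.
rewrite hsubmxK -zE -[RHS]hsubmxK; congr row_mx.
by apply/rowP => i; rewrite !ord1 !mxE eqxx mulr1n.
Qed.

End semialgebraic_maps.

(** * Semialgebraic sets with empty interior *)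

Section row_vector_topology.
Context {R : realType}.

Lemma rV_ballE {k} (x y : 'rV[R]_k) e :
  ball x e y <-> 0 < e /\ forall i, `|x 0 i - y 0 i| < e.
Proof.
by split=> -[e0 xy]; split=> // i; [apply: xy|move=> j; rewrite ord1; apply: xy].
Qed.

Lemma rV_norm_le {k} (x : 'rV[R]_k) e :
  0 <= e -> (`|x| <= e <-> forall i, `|x 0 i| <= e).
Proof.
move=> e0; rewrite [`|x|]/Num.Def.normr /= mx_normrE.
split=> [/bigmax_leP[_ h] i|h]; first exact: (h (0, i)).
by apply/bigmax_leP; split=> // -[i j] _; rewrite ord1; apply: h.
Qed.

Lemma rV_coord_le {k} (x : 'rV[R]_k) i : `|x 0 i| <= `|x|.
Proof. by have /rV_norm_le := lexx `|x|; apply. Qed.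

Lemma nbhs_row_mxr {n m} (x : 'rV[R]_n) (a : 'rV[R]_m) (S : set 'rV[R]_(n + m)) :
  nbhs (row_mx x a) S -> nbhs a [set b | S (row_mx x b)].
Proof.
move=> /nbhs_ballP[e e0 eS]; apply/nbhs_ballP; exists e => // b /rV_ballE[_ ab].
apply: eS; apply/rV_ballE; split=> // i; case: (split_ordP i) => j ->.
  by rewrite !row_mxEl subrr normr0.
by rewrite !row_mxEr.
Qed.

Lemma polyfun_continuous {k} (f : 'rV[R]_k -> R) : polyfun f -> continuous f.
Proof.
elim=> [c|i|g h _ cg _ ch|g h _ cg _ ch] x.
- exact: cst_continuous.
- exact: coord_continuous.
- exact: (cvgD (cg x) (ch x)).
- exact: (cvgM (cg x) (ch x)).
Qed.

Lemma polyfun_line {k} (f : 'rV[R]_k -> R) x v : polyfun f ->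
  exists q : {poly R}, forall t, f (x + t *: v) = q.[t].
Proof.
elim=> [c|i|g h _ [p pE] _ [q qE]|g h _ [p pE] _ [q qE]].
- by exists c%:P => t; rewrite hornerC.
- by exists ((x 0 i)%:P + 'X * (v 0 i)%:P) => t; rewrite !hornerE !mxE.
- by exists (p + q) => t; rewrite hornerD pE qE.
- by exists (p * q) => t; rewrite hornerM pE qE.
Qed.

(** The [size q] distinct points [d / (i + 2)] lie strictly between 0 and [d] and outnumber the
    roots of [q]. *)
Lemma poly_nonzero_near0 (q : {poly R}) (d : R) : q != 0 -> 0 < d ->
  exists t, [/\ 0 < t, t < d & q.[t] != 0].
Proof.
move=> q0 d0; apply: contrapT => h.
pose s := [seq d / (i.+2)%:R | i <- iota 0 (size q)].
have := @max_poly_roots _ q s q0; rewrite size_map size_iota ltnn.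
suff [-> ->] : all (root q) s /\ uniq s by move=> /(_ isT isT).
split.
  apply/allP => _ /mapP[i _ ->]; rewrite rootE; apply/negPn/negP => nz; apply: h.
  exists (d / i.+2%:R); split=> //; first by rewrite divr_gt0.
  by rewrite ltr_pdivrMr // ltr_pMr // ltr1n.
rewrite map_inj_uniq ?iota_uniq // => i j /(mulfI (lt0r_neq0 d0))/invr_inj/eqP.
by rewrite eqr_nat => /eqP[].
Qed.

(** Along the line from [x] through [y], [f] is a univariate polynomial that does not vanish at 1,
    so it has nonzero values at arbitrarily small positive times. *)
Lemma polyfun_nonzero_near {k} (f : 'rV[R]_k -> R) y (x : 'rV[R]_k) U :
  polyfun f -> f y != 0 -> nbhs x U -> exists2 z, U z & f z != 0.
Proof.
move=> pf fy /nbhs_ballP[e /= e0 eU].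
have [q qE] := polyfun_line x (y - x) pf.
have q0 : q != 0.
  apply: contraNneq fy => q0.
  by have := qE 1; rewrite scale1r subrKC q0 horner0 => ->.
pose d := e / (`|y - x| + 1).
have y1 : 0 < `|y - x| + 1 by rewrite ltr_wpDl.
have d0 : 0 < d by rewrite divr_gt0.
have [t [t0 td qt]] := poly_nonzero_near0 q0 d0.
exists (x + t *: (y - x)); last by rewrite qE.
apply: eU; apply/rV_ballE; split=> // i.
rewrite !mxE opprD addNKr normrN normrM gtr0_norm //.
have yi : `|y 0 i - x 0 i| <= `|y - x|.
  by have := rV_coord_le (y - x) i; rewrite !mxE.
apply: (le_lt_trans (ler_wpM2l (ltW t0) yi)).
apply: (@le_lt_trans _ _ (t * (`|y - x| + 1))).
  by rewrite (ler_pM2l t0) lerDl.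
by rewrite -ltr_pdivlMr.
Qed.

(** A cell whose equations are all trivial is cut out by strict inequalities, hence open; without
    interior it is empty, and the constant 1 vanishes on it vacuously. *)
Lemma semialgebraic_thin {k} (A : set 'rV[R]_k) : semialgebraic A ->
  (forall x : 'rV[R]_k, ~ nbhs x A) ->
  exists P, [/\ polyfun P, exists x, P x != 0 & forall x, A x -> P x = 0].
Proof.
move=> [s ->]; elim: s => [|[ps qs] s IHs] /= thin.
  exists (fun=> 1); split=> //; first exact: polyfun_cst.
  by exists 0; rewrite oner_eq0.
have [|P [pP [y Py] PA]] := IHs.
  by move=> x nx; apply: (thin x); apply: filterS nx => z /= ->; rewrite orbT.
suff [Q [pQ [z Qz] QA]] : exists Q : 'rV[R]_k -> R, [/\ polyfun Q,
    exists x, Q x != 0 & forall x, basic_semialgebraic ps qs x -> Q x = 0].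
  exists (fun x => Q x * P x); split=> [||x /orP[/QA->|/PA->]].
  - exact: polyfun_mul.
  (* The product is not identically zero: [Q] takes a nonzero value inside the neighbourhood of [y]
     where [P] does not vanish. *)
  - have cP : nbhs y [set x | P x != 0].
      have cP : P x @[x --> y] --> P y by exact: polyfun_continuous.
      exact: cvgr_neq0 cP Py.
    have [w Pw Qw] := polyfun_nonzero_near pQ Qz cP.
    by exists w; rewrite mulf_neq0.
  - by rewrite mul0r.
  - by rewrite mulr0.
have [[p [pps [z pz]]]|ps0] := pselect (exists p, p \in ps /\ exists z, peval p z != 0).
  exists (peval p); split; [exact: polyfun_peval|by exists z|].
  by move=> x /andP[/allP/(_ _ pps)/eqP].
exists (fun=> 1); split; [exact: polyfun_cst|by exists 0; rewrite oner_eq0|].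
move=> x /andP[_ qx]; exfalso; apply: (thin x).
have nq : nbhs x [set z | all (fun q => 0 < peval q z) qs].
  elim: (qs) qx => [|q qs' IHq] /=; first by move=> _; apply: filterS filterT.
  move=> /andP[qx /IHq]; have cq : peval q z @[z --> x] --> peval q x.
    exact/polyfun_continuous/polyfun_peval.
  have nq : nbhs x [set z | 0 < peval q z] by exact: cvgr_gt cq _ qx.
  by apply: filterS2 nq => z /= -> ->.
apply: filterS nq => z qz; apply/orP; left; apply/andP; split=> //.
by apply/allP => p pps; apply/negPn/negP => pz; apply: ps0; exists p; split=> //; exists z.
Qed.

(** Used twice: with the base point [x] for the critical values, and with a radius in place of [x]
    to exhaust the space of [y]. *)
Lemma semialgebraic_thin_fibers {n m} (S : set 'rV[R]_(n + m)) :
  semialgebraic S -> (forall x (a : 'rV[R]_m), ~ nbhs a [set b | S (row_mx x b)]) ->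
  exists q : 'rV[R]_m -> R, [/\ polyfun q, exists a, q a != 0 &
    forall a, q a != 0 -> exists P : 'rV[R]_n -> R,
      [/\ polyfun P, exists x, P x != 0 & forall x, S (row_mx x a) -> P x = 0]].
Proof.
move=> sS thin; have [|P [pP [z Pz] PS]] := semialgebraic_thin sS.
  by move=> z; rewrite -[z]hsubmxK => /nbhs_row_mxr; apply: thin.
exists (fun a => P (row_mx (lsubmx z) a)); split.
- apply: polyfun_comp => // i; case: (split_ordP i) => j ->.
    by under eq_fun do rewrite row_mxEl; apply: polyfun_cst.
  by under eq_fun do rewrite row_mxEr; apply: polyfun_coord.
- by exists (rsubmx z); rewrite hsubmxK.
- move=> a Pa; exists (fun x => P (row_mx x a)); split.
  + apply: polyfun_comp => // i; case: (split_ordP i) => j ->.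
      by under eq_fun do rewrite row_mxEl; apply: polyfun_coord.
    by under eq_fun do rewrite row_mxEr; apply: polyfun_cst.
  + by exists (lsubmx z).
  + by move=> x /PS.
Qed.

(* For a parameter [a] in the interior of the union, a nonzero polynomial in [t]
   would vanish on a half-line; this replaces a Baire category argument. *)
Lemma semialgebraic_increasing_thin {m} (S : set 'rV[R]_(1 + m)) :
  semialgebraic S ->
  (forall t t' a, t <= t' ->
    S (row_mx (const_mx t) a) -> S (row_mx (const_mx t') a)) ->
  (forall t (a : 'rV[R]_m), ~ nbhs a [set b | S (row_mx (const_mx t) b)]) ->
  forall a : 'rV[R]_m, ~ nbhs a [set b | exists t, S (row_mx (const_mx t) b)].
Proof.
move=> sS incrS thin a nU.
have cst (x : 'rV[R]_1) : x = const_mx (x 0 0).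
  by apply/rowP => i; rewrite mxE ord1.
have [|q [pq [b qb] qP]] := semialgebraic_thin_fibers sS.
  by move=> x; rewrite (cst x); apply: thin.
have [c [t Stc] /qP[P [pP [y Py] PS]]] := polyfun_nonzero_near pq qb nU.
(* The ball of radius 1 about [t + 1] stays in the half-line above [t], where monotonicity forces
   [P] to vanish. *)
have nt : nbhs (const_mx (t + 1) : 'rV[R]_1) [set x | t <= x 0 0].
  apply/nbhs_ballP; exists 1 => //= x /rV_ballE[_ /(_ 0)]; rewrite mxE.
  by rewrite ltr_distlC => /andP[]; rewrite addrK => /ltW.
have [x tx /eqP[]] := polyfun_nonzero_near pP Py nt.
by apply: PS; rewrite (cst x); apply: incrS Stc.
Qed.

End row_vector_topology.

(** * Sard theorem for C1 maps between spaces of equal dimension *)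

Lemma rV_ball_compact {R : realType} {m} (T : R) :
  compact [set v : 'rV[R]_m | `|v| <= T].
Proof.
have [T0|T0] := leP 0 T; last first.
  rewrite (_ : mkset _ = set0); first exact: compact0.
  by rewrite predeqE => v; split=> //= /(le_trans (normr_ge0 v)); rewrite leNgt T0.
rewrite (_ : mkset _ = [set v : 'rV[R]_m | forall i, `[-T, T]%classic (v ord0 i)]).
  by apply: (@rV_compact _ _ (fun=> `[-T, T]%classic)) => _; apply: segment_compact.
rewrite predeqE => v; split=> [/(rV_norm_le _ T0) h i|h] /=.
  by rewrite in_itv /= -ler_norml.
by apply/(rV_norm_le _ T0) => i; have := h i; rewrite /= in_itv /= -ler_norml.
Qed.

Section compact_balls.
Context {R : realType} {m : nat}.
Implicit Types (f : 'rV[R]_m -> R) (T : R).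

(** Heine's theorem, through the near-covering form of compactness. Only [x] is confined to the
    ball, and the bound holds for all small [d], so that finitely many functions can share one
    [d]. *)
Lemma uniform_continuity_ball f T e : continuous f -> 0 < e ->
  \forall d \near 0^'+, forall x y, `|x| <= T -> `|x - y| <= d ->
    `|f x - f y| <= e.
Proof.
move=> cf e0; have /compact_near_coveringP := @rV_ball_compact R m T.
move=> /(_ R 0^'+ (fun d x => forall y, `|x - y| <= d -> `|f x - f y| <= e)).
have H x : [set v : 'rV[R]_m | `|v| <= T] x ->
    \forall x' \near x & d \near 0^'+, forall y,
      `|x' - y| <= d -> `|f x' - f y| <= e.
  move=> _; have e2 : 0 < e / 2 by rewrite divr_gt0.
  have cx : f y @[y --> x] --> f x by exact: cf.
  have cx' : nbhs x [set y | `|f x - f y| <= e / 2] by apply: (cvgr_dist_le _ _ cx).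
  move/nbhs_ballP: cx' => [r /= r0 rP].
  have r2 : 0 < r / 2 by rewrite divr_gt0.
  exists (ball x (r / 2), [set d : R | d < r / 2]) => /=.
    by split; [exact: nbhsx_ballx|exact: nbhs_right_lt].
  move=> [x' d] /= [xx' dr] y x'y.
  have h1 : `|f x - f x'| <= e / 2.
    by apply: rP; apply: le_ball xx'; rewrite ler_pdivrMr // ler_pMr // ler1n.
  have h2 : `|f x - f y| <= e / 2.
    apply: rP; move: xx'; rewrite -!ball_normE /= => xx'.
    rewrite -(subrK x' x) -addrA (le_lt_trans (ler_normD _ _)) //.
    by rewrite (splitr r) ltrD // (le_lt_trans x'y).
  rewrite -(subrK (f x) (f x')) -addrA (le_trans (ler_normD _ _)) //.
  by rewrite (splitr e) lerD // distrC.
move=> /(_ _ H) h; apply: filterS h => d h x y xT; exact: h.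
Qed.

Lemma bounded_ball f T : continuous f ->
  \forall M \near +oo, forall x, `|x| <= T -> `|f x| <= M.
Proof.
move=> cf; have := continuous_compact (continuous_subspaceT cf) (@rV_ball_compact R m T).
move=> /compact_bounded bf.
have [M0 [M0r hM]] := bf; exists M0; split=> // M /hM h x xT.
by apply: h; exists x.
Qed.

End compact_balls.

Section C1_functions.
Context {R : realType}.

Lemma mean_value {V : normedModType R} (f : V -> R) (x y : V) :
  (forall p, differentiable f p) ->
  exists s, [/\ 0 < s, s < 1 & f y - f x = 'd f (x + s *: (y - x)) (y - x)].
Proof.
move=> df; pose v := y - x; pose phi (s : R) := f (x + s *: v).
have dphi (s : R) : is_derive s 1 phi ('d f (x + s *: v) v).
  have dfs := diff_derivable (v := v) (df (x + s *: v)).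
  have E : (fun h : R => h^-1 *: ((phi \o shift s) (h *: (1 : R)) - phi s)) =
      (fun h : R => h^-1 *: ((f \o shift (x + s *: v)) (h *: v) - f (x + s *: v))).
    apply/funext => h; rewrite /phi /=.
    have -> : h *: (1 : R) = h by exact: mulr1.
    by rewrite scalerDl addrCA.
  apply: DeriveDef; first by rewrite /derivable E.
  by rewrite -deriveE // /derive E.
have cphi : {within `[0, 1], continuous phi}.
  apply: continuous_subspaceT => s; apply: differentiable_continuous.
  by apply/derivable1_diffP.
have [s] := MVT ltr01 (fun s _ => dphi s) cphi.
rewrite in_itv /= => /andP[s0 s1].
rewrite /phi scale0r scale1r addr0 subrKC subr0 mulr1 => ->.
by exists s.
Qed.

Lemma diff_coord_sum {m} (f : 'rV[R]_m -> R) p v :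
  differentiable f p ->
  'd f p v = \sum_i v 0 i * 'd f p (delta_mx 0 i).
Proof.
move=> df; rewrite {1}(row_sum_delta v) linear_sum /=.
by apply: eq_bigr => i _; rewrite linearZ.
Qed.

(** By the mean value theorem the error is [('d f z - 'd f x) (y - x)] with [z] on the segment, and
    the partial derivatives are uniformly continuous near the ball. *)
Lemma uniform_differentiability {m} (f : 'rV[R]_m -> R) T e : C1 f -> 0 < e ->
  \forall d \near 0^'+, forall x y, `|x| <= T -> `|y - x| <= d ->
    `|f y - f x - 'd f x (y - x)| <= e * `|y - x|.
Proof.
move=> [df cf] e0; have e1 : 0 < e / m.+1%:R by rewrite divr_gt0.
have : \forall d \near 0^'+, forall i : 'I_m, forall x y : 'rV[R]_m,
    `|x| <= T -> `|x - y| <= d ->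
    `|'d f x (delta_mx 0 i) - 'd f y (delta_mx 0 i)| <= e / m.+1%:R.
  by apply: filter_forall => i; apply: uniform_continuity_ball => //; apply: cf.
apply: filterS => d dP x y xT yx.
have E p := diff_coord_sum (y - x) (df p).
have [z xz fE] : exists2 z, `|x - z| <= d & f y - f x = 'd f z (y - x).
  have [s [s0 s1 fE]] := mean_value x y df.
  exists (x + s *: (y - x)) => //; rewrite opprD addNKr normrN normrZ gtr0_norm //.
  by apply: le_trans yx; rewrite ler_piMl // ltW.
have -> : f y - f x - 'd f x (y - x) = \sum_i ((y - x) 0 i * 'd f z (delta_mx 0 i)
    - (y - x) 0 i * 'd f x (delta_mx 0 i)).
  rewrite fE sumrB; congr (_ - _); [exact: (E z)|exact: (E x)].
apply: (@le_trans _ _ (\sum_(i < m) (`|y - x| * (e / m.+1%:R)))).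
  apply: (le_trans (ler_norm_sum _ _ _)); apply: ler_sum => i _.
  by rewrite -mulrBr normrM ler_pM ?rV_coord_le // distrC dP.
rewrite sumr_const card_ord -mulrnAr -[_ *+ m]mulr_natr mulrC ler_wpM2r //.
by rewrite mulrAC ler_pdivrMr // ler_pM2l // ler_nat.
Qed.

Lemma lipschitz_ball {m} (f : 'rV[R]_m -> R) T : C1 f ->
  \forall M \near +oo, forall x y, `|x| <= T -> `|y| <= T ->
    `|f y - f x| <= M * `|y - x|.
Proof.
move=> [df cf].
have : \forall M \near +oo, forall i : 'I_m, forall x : 'rV[R]_m,
    `|x| <= T -> `|'d f x (delta_mx 0 i)| <= M.
  by apply: filter_forall => i; apply: bounded_ball; apply: cf.
move=> [M0 [M0r hM]].
near=> M => x y xT yT.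
have [z zT fE] : exists2 z, `|z| <= T & f y - f x = 'd f z (y - x).
  have [s [s0 s1 fE]] := mean_value x y df.
  exists (x + s *: (y - x)) => //.
  have -> : x + s *: (y - x) = (1 - s) *: x + s *: y.
    by rewrite scalerBl scale1r scalerBr addrA addrAC.
  apply: (le_trans (ler_normD _ _)); rewrite !normrZ !gtr0_norm ?subr_gt0 //.
  have -> : T = (1 - s) * T + s * T by ring.
  by rewrite lerD // ler_wpM2l // ltW // subr_gt0.
have -> : f y - f x = \sum_i (y - x) 0 i * 'd f z (delta_mx 0 i).
  by rewrite fE; exact: diff_coord_sum.
(* The budget [M] is shared among [m] partial derivatives; the successor keeps the division
   meaningful in dimension 0. *)
pose N := M / m.+1%:R.
have NM0 : M0 < N.
  rewrite ltr_pdivlMr //; near: M; apply: nbhs_pinfty_gt; exact: num_real.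
have N0 : 0 <= N.
  rewrite divr_ge0 //; near: M; apply: nbhs_pinfty_ge; exact: num_real.
apply: (@le_trans _ _ (\sum_(i < m) (`|y - x| * N))).
  apply: (le_trans (ler_norm_sum _ _ _)); apply: ler_sum => i _.
  by rewrite normrM ler_pM ?rV_coord_le // hM.
rewrite sumr_const card_ord -mulrnAr -[_ *+ m]mulr_natr mulrC ler_wpM2r //.
by rewrite mulrAC ler_pdivrMr // ler_wpM2l ?ler_nat //; near: M;
  apply: nbhs_pinfty_ge; exact: num_real.
Unshelve. all: by end_near. Qed.

End C1_functions.

(* Cells are the fibres of [cell].  Within a fibre all points lie in a window of
   width [W], and one coordinate is determined by the others; the latter encodes
   that a fibre lies near a hyperplane. *)
Lemma grid_count (m M N W : nat)
    (cell : {ffun 'I_m.+1 -> 'I_M} -> {ffun 'I_m.+1 -> 'I_N}) :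
  (forall c c', cell c = cell c' -> forall j, (c j < c' j + W)%N) ->
  (forall c0, exists i, forall c c', cell c = cell c0 -> cell c' = cell c0 ->
     (forall j, j != i -> c j = c' j) -> c i = c' i) ->
  (M ^ m.+1 <= N ^ m.+1 * (2 * W) ^ m)%N.
Proof.
move=> window plane.
have -> : (M ^ m.+1)%N = #|{ffun 'I_m.+1 -> 'I_M}| by rewrite card_ffun !card_ord.
have -> : (N ^ m.+1)%N = #|{ffun 'I_m.+1 -> 'I_N}| by rewrite card_ffun !card_ord.
rewrite -sum1_card (partition_big cell xpredT) //= -sum_nat_const.
apply: leq_sum => b _; rewrite sum1_card.
have [c0 /eqP cb|no_c] := pickP [pred c | cell c == b]; last first.
  by rewrite (eq_card0 no_c).
case: W window => [|W] window.
  by have := window c0 c0 erefl ord0; rewrite addn0 ltnn.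
have [i ci] := plane c0.
(* An element of the fibre is coded by the offsets from [c0] of its coordinates other than [i]. The
   shift by [W.+1] keeps them natural, the window keeps them below [2 * W.+1], and the coordinate
   [i] is recovered from [plane]. *)
pose code (c : {ffun 'I_m.+1 -> 'I_M}) : {ffun 'I_m -> 'I_(2 * W.+1)} :=
  [ffun j => inord (c (lift i j) + W.+1 - c0 (lift i j))].
have -> : ((2 * W.+1) ^ m)%N = #|{ffun 'I_m -> 'I_(2 * W.+1)}|.
  by rewrite card_ffun !card_ord.
rewrite -(@card_in_imset _ _ code) ?max_card // => c c'.
move=> Hc Hc' /ffunP codeE.
have /eqP cc : cell c == b := Hc.
have /eqP cc' : cell c' == b := Hc'.
have coordE j : j != i -> c j = c' j.
  move=> ji; have [l ->] : exists l, j = lift i l.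
    by case: (unliftP i j) => [l ->|ji']; [exists l|rewrite ji' eqxx in ji].
  have := codeE l; rewrite !ffunE => /(congr1 val).
  have W1 : (c (lift i l) < c0 (lift i l) + W.+1)%N by apply: window; rewrite cc.
  have W1' : (c0 (lift i l) < c (lift i l) + W.+1)%N by apply: window; rewrite cc.
  have W2 : (c' (lift i l) < c0 (lift i l) + W.+1)%N by apply: window; rewrite cc'.
  have W2' : (c0 (lift i l) < c' (lift i l) + W.+1)%N by apply: window; rewrite cc'.
  have bound p s : (p < s + W.+1 -> s < p + W.+1 ->
      p + W.+1 - s < (2 * W.+1).-1.+1)%N by lia.
  have cancel p q s : (s < p + W.+1 -> s < q + W.+1 ->
      p + W.+1 - s = q + W.+1 - s -> p = q)%N by lia.
  rewrite /= (inordK (bound _ _ W1 W1')) (inordK (bound _ _ W2 W2')).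
  by move=> E; apply: val_inj; apply: cancel E.
apply/ffunP => j; have [->|/coordE//] := eqVneq j i.
by apply: ci => //; rewrite ?cc ?cc'.
Qed.

Section sard.
Context {R : realType}.

(* Subdivide the ball into [N ^ m.+1] cubes and the hypothetical ball of
   critical values into a grid of [(r N) ^ m.+1] points.  By uniform
   differentiability a cube containing critical points has its critical values
   near a hyperplane, so it accounts for a number of grid points of order
   [r ^ m] only. *)
Lemma sard_ball {m} (F : 'I_m -> 'rV[R]_m -> R) T : (forall i, C1 (F i)) ->
  forall a : 'rV[R]_m, ~ nbhs a [set b | exists y, [/\ `|y| <= T,
    \det (\matrix_(i, j) 'd (F i) y (delta_mx 0 j)) = 0 &
    forall i, F i y = b 0 i]].
Proof.
case: m F => [|m] F C1F a.
  move=> /nbhs_singleton[y [_]]; rewrite det_mx00 => /eqP.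
  by rewrite oner_eq0.
move=> /[dup] /nbhs_singleton[y0 [y0T _ _]].
move=> /nbhs_ballP[c /= c0 ball_c].
have T0 : 0 <= T by apply: le_trans y0T.
(* The margin 1 makes the shifted coordinates [y + L] strictly less than [2 * L], so that every cell
   index is below [N]. *)
pose L := T + 1; have L0 : 0 < L by rewrite ltr_wpDl.
have [K K0 KP] : exists2 K, 0 < K & forall i x y, `|x| <= T -> `|y| <= T ->
    `|F i y - F i x| <= K * `|y - x|.
  by apply: pinfty_ex_gt0; apply: filter_forall => i; apply: lipschitz_ball.
(* A cube of side [h = 2 * L / N] has image of width at most [K * h], that is [2 * L * K * r / c]
   steps of the grid of mesh [c / M]. Hence the window [Q * r]. *)
pose Q := (Num.truncn (2 * L * K / c)).+1.
have QP : 2 * L * K / c < Q%:R by apply: truncnS_gt.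
(* The smallest refinement that makes the final count [r <= (2 * Q) ^ m] absurd. *)
pose r := ((2 * Q) ^ m).+1; have r0 : 0 < r%:R :> R by rewrite ltr0n.
(* Solves [2 * m.+1 * e * h = (c / M) / 2]: the distance to the hyperplane, counted for two points,
   is half a grid step. *)
pose e := c / (8 * m.+1%:R * L * r%:R).
have e0 : 0 < e by rewrite divr_gt0 // !mulr_gt0.
have [d [d0 dP]] : exists d, 0 < d /\ forall i x y, `|x| <= T ->
    `|y - x| <= d -> `|F i y - F i x - 'd (F i) x (y - x)| <= e * `|y - x|.
  have : \forall d \near 0^'+, forall i x y, `|x| <= T ->
      `|y - x| <= d -> `|F i y - F i x - 'd (F i) x (y - x)| <= e * `|y - x|.
    by apply: filter_forall => i; apply: uniform_differentiability.
  move=> /(filterI (nbhs_right_gt (0 : R)))/filter_ex[d [d0 dP]].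
  by exists d.
pose n := Num.truncn (2 * L / d); pose N := n.+1.
have N0 : 0 < N%:R :> R by rewrite ltr0n.
pose h := 2 * L / N%:R.
have h0 : 0 < h by rewrite divr_gt0 // mulr_gt0.
have hd : h <= d.
  by rewrite /h ler_pdivrMr // -ler_pdivrMl // mulrC ltW //; exact: truncnS_gt.
pose M := (r * N)%N.
have M0 : 0 < M%:R :> R by rewrite ltr0n.
pose pt (k : {ffun 'I_m.+1 -> 'I_M}) : 'rV[R]_m.+1 :=
  a + \row_j (c / M%:R * (k j)%:R).
have /choice[y yP] k : exists y, [/\ `|y| <= T,
    \det (\matrix_(i, j) 'd (F i) y (delta_mx 0 j)) = 0 &
    forall i, F i y = pt k 0 i].
  apply: ball_c; apply/rV_ballE; split=> // i.
  rewrite !mxE opprD addNKr normrN ger0_norm; last first.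
    by rewrite mulr_ge0 // divr_ge0 // ltW.
  by rewrite -mulrA gtr_pMr // mulrC ltr_pdivrMr // mul1r ltr_nat.
pose cell (k : {ffun 'I_m.+1 -> 'I_M}) : {ffun 'I_m.+1 -> 'I_N} :=
  [ffun i => inord (Num.truncn ((y k 0 i + L) / h))].
have yL k i : 0 <= y k 0 i + L /\ y k 0 i + L < 2 * L.
  have [yT _ _] := yP k; have := le_trans (rV_coord_le (y k) i) yT.
  rewrite ler_norml /L => /andP[]; lra.
have cellP k k' : cell k = cell k' -> `|y k - y k'| <= h.
  move=> /ffunP kk'; apply/rV_norm_le; first exact: ltW.
  move=> i; have := kk' i; rewrite !ffunE !mxE => /(congr1 val) /=.
  have [l1 l2] := yL k i; have [l3 l4] := yL k' i.
  have t1 : 0 <= (y k 0 i + L) / h by rewrite divr_ge0 // ltW.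
  have t2 : 0 <= (y k' 0 i + L) / h by rewrite divr_ge0 // ltW.
  have hN : N%:R * h = 2 * L by rewrite /h mulrC divfK // gt_eqF.
  rewrite !inordK; last 2 first.
  - by rewrite truncn_lt_nat // ltr_pdivrMr // hN.
  - by rewrite truncn_lt_nat // ltr_pdivrMr // hN.
  move=> E; have := truncn_itv t1; have := truncn_itv t2; rewrite E.
  set q := Num.truncn _; rewrite !(ler_pdivlMr _ _ h0) !(ltr_pdivrMr _ _ h0) -natr1.
  by rewrite ler_norml => /andP[b1 b2] /andP[b3 b4]; apply/andP; split; lra.
have FE k k' i : F i (y k) - F i (y k') = c / M%:R * ((k i)%:R - (k' i)%:R).
  have [_ _ ->] := yP k; have [_ _ ->] := yP k'; rewrite !mxE; ring.
have hM : h * M%:R = 2 * L * r%:R.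
  by rewrite /h /M natrM; field; rewrite gt_eqF.
have : (M ^ m.+1 <= N ^ m.+1 * (2 * (Q * r)) ^ m)%N.
  apply: (grid_count (cell := cell)) => [k k' kk' j|k0].
  - have [yT _ _] := yP k; have [yT' _ _] := yP k'.
    have := KP j _ _ yT' yT; rewrite FE => /(le_trans (ler_norm _)).
    move=> /le_trans/(_ (ler_wpM2l (ltW K0) (cellP _ _ kk'))).
    rewrite mulrAC ler_pdivrMr // -mulrA hM => le1.
    rewrite -(ltr_nat R) natrD natrM -ltrBlDl -(ltr_pM2l c0).
    apply: (le_lt_trans le1); move: QP; rewrite ltr_pdivrMr // => QP.
    by rewrite mulrA -subr_gt0; nra.
  (* The left kernel vector [l] of the singular Jacobian is normal to a hyperplane containing the
     image of the differential. Its largest entry selects the coordinate [i] determined by the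
     others: the quotients by [l 0 i] stay bounded. *)
  - have [y0T' /eqP/det0P[l l0 lJ] _] := yP k0.
    have [i li] : exists i, forall j, `|l 0 j| <= `|l 0 i|.
      by case: (@arg_maxP _ R _ ord0 xpredT (fun j => `|l 0 j|)) => // i _ ip;
        exists i => j; apply: ip.
    have li0 : 0 < `|l 0 i|.
      rewrite normr_gt0; apply: contra_neq l0 => li0; apply/rowP => j.
      have := li j; rewrite li0 normr0 mxE => lj0; apply/eqP.
      by rewrite -normr_eq0 eq_le lj0 normr_ge0.
    have small k : cell k = cell k0 ->
        `|\sum_j l 0 j * (c / M%:R * ((k j)%:R - (k0 j)%:R))| <=
          m.+1%:R * (`|l 0 i| * (e * h)).
      move=> kk0; have yh := cellP _ _ kk0.
      rewrite (eq_bigr (fun j => l 0 j *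
          (F j (y k) - F j (y k0) - 'd (F j) (y k0) (y k - y k0)) +
          l 0 j * 'd (F j) (y k0) (y k - y k0))); last first.
        by move=> j _; rewrite -mulrDr subrK FE.
      (* The linear part cancels because [l] annihilates the Jacobian; only the error of
         differentiability remains. *)
      rewrite big_split /= [X in _ + X](_ : _ = 0) ?addr0; last first.
        pose v := y k - y k0.
        transitivity (\sum_j v 0 j *
          (l *m \matrix_(i, j) 'd (F i) (y k0) (delta_mx 0 j)) 0 j); last first.
          rewrite lJ big1 // => j _; apply/eqP; rewrite mulf_eq0; apply/orP; right.
          by rewrite mxE.
        transitivity (\sum_j \sum_p v 0 p *
            (l 0 j * 'd (F j) (y k0) (delta_mx 0 p))).
          apply: eq_bigr => j _; rewrite -/v (diff_coord_sum v (proj1 (C1F j) _)).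
          by rewrite mulr_sumr; apply: eq_bigr => p _; rewrite mulrCA.
        rewrite exchange_big; apply: eq_bigr => p _ /=.
        rewrite [X in v 0 p * X]mxE mulr_sumr.
        by apply: eq_bigr => j _; congr (_ * (_ * _)); rewrite mxE.
      apply: (le_trans (ler_norm_sum _ _ _)).
      apply: (@le_trans _ _ (\sum_(j < m.+1) `|l 0 i| * (e * h))); last first.
        by rewrite sumr_const card_ord -[_ *+ m.+1]mulr_natl.
      apply: ler_sum => j _; rewrite normrM ler_pM //.
      apply: (le_trans (dP _ _ _ y0T' (le_trans yh hd))).
      by rewrite ler_pM2l.
    exists i => k k' kk0 kk0' coordE; apply/val_inj/eqP => /=.
    have := le_trans (ler_normB _ _) (lerD (small _ kk0) (small _ kk0')).
    rewrite -sumrB (bigD1 i) //= big1 ?addr0; last first.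
      by move=> j ji; rewrite coordE // subrr.
    pose D : R := (k i)%:R - (k' i)%:R.
    rewrite [X in `|X|](_ : _ = l 0 i * (c / M%:R * D)); last by rewrite /D; ring.
    rewrite normrM [`|_ * D|]normrM (gtr0_norm (divr_gt0 c0 M0)) => le1.
    have le2 : c / M%:R * `|D| <= 2 * (m.+1%:R * (e * h)).
      rewrite -(ler_pM2l li0); apply: (le_trans le1).
      by rewrite le_eqVlt; apply/orP; left; apply/eqP; ring.
    (* [D] is a difference of integers, so half a step forces equality. *)
    have le3 : `|D| <= 1 / 2.
      rewrite -(ler_pM2l (divr_gt0 c0 M0)); apply: (le_trans le2).
      rewrite -(ler_pM2r M0).
      have -> : 2 * (m.+1%:R * (e * h)) * M%:R = 2 * m.+1%:R * e * (h * M%:R).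
        by ring.
      have -> : c / M%:R * (1 / 2) * M%:R = c / 2 by field; rewrite gt_eqF.
      rewrite hM /e le_eqVlt; apply/orP; left; apply/eqP; field.
      by rewrite !gt_eqF.
    have [//|neq] := eqVneq (k i : nat) (k' i).
    have : 1 <= `|D|.
      rewrite /D; case: (ltngtP (k i) (k' i)) neq => // lt_k _.
        rewrite distrC ger0_norm; first by rewrite lerBrDl natr1 ler_nat.
        by rewrite subr_ge0 ler_nat ltnW.
      rewrite ger0_norm; first by rewrite lerBrDl natr1 ler_nat.
      by rewrite subr_ge0 ler_nat ltnW.
    by move=> le4; exfalso; lra.
(* Cancelling [N ^ m.+1] and [r ^ m] leaves [r <= (2 * Q) ^ m]. *)
rewrite /M expnMn mulnC leq_pmul2l ?expn_gt0 // mulnA expnMn expnS.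
by rewrite leq_pmul2r ?expn_gt0 // ltnn.
Qed.

End sard.

(** * Polynomial zero sets are Lebesgue-null *)

Section lebesgue_null.
Context {R : realType}.

Lemma box_volume_ge0 {m} (a b : 'rV[R]_m) : 0 <= box_volume a b.
Proof. by apply: prodr_ge0 => i _; rewrite le_max lexx. Qed.

(** Exhaustion by balls of integer radius, with tolerance [e / 2 ^ k.+1] for the ball of radius [k].
    The resulting sequence of finite lists is turned into one family of boxes indexed by codes of
    pairs (list, position). *)
Lemma lebesgue_outer_null {m} (Z : set 'rV[R]_m) :
  (forall (k : nat) (e : R), 0 < e -> exists s : seq ('rV[R]_m * 'rV[R]_m),
     (forall x, Z x -> `|x| <= k%:R -> exists2 c, c \in s & box c.1 c.2 x) /\
     \sum_(c <- s) box_volume c.1 c.2 <= e) ->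
  lebesgue_outer Z = 0%E.
Proof.
move=> cover; apply/eqP; rewrite eq_le; apply/andP; split; last first.
  apply: le_ereal_inf_tmp => _ [D [a [b [_ ->]]]]; apply: esum_ge0 => k _.
  by rewrite lee_fin box_volume_ge0.
apply/lee_addgt0Pr => e e0; rewrite add0e.
have e2 (k : nat) : 0 < e / (2 ^ k.+1)%:R by rewrite divr_gt0 // ltr0n expn_gt0.
have /choice[s sP] k := cover k _ (e2 k).
pose J k := `I_(size (s k)).
pose D : set nat := pickle @` ([set: nat] `*`` J).
pose bx p := nth (0, 0) (s p.1) p.2.
pose dec n := if unpickle n is Some p then bx p else (0, 0).
apply: ge_ereal_inf; exists (\esum_(n in D) (box_volume (dec n).1 (dec n).2)%:E)%E.
  exists D, (fun n => (dec n).1), (fun n => (dec n).2); split=> // x Zx.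
  pose k := Num.truncn `|x|.
  have xk : `|x| <= k.+1%:R by rewrite ltW // truncnS_gt.
  have [c cs cx] := (sP k.+1).1 x Zx xk.
  exists (pickle (k.+1, index c (s k.+1))).
    by exists (k.+1, index c (s k.+1)) => //; split=> //=; rewrite /J /= index_mem.
  by rewrite /dec pickleK /bx /= nth_index.
rewrite (reindex_esum ([set: nat] `*`` J) D pickle); last first.
  split=> //; first by move=> p pJ; exists p.
  by move=> p p' _ _ /(pcan_inj pickleK).
rewrite (eq_esum (b := fun p => (box_volume (bx p).1 (bx p).2)%:E)); last first.
  by move=> p _; rewrite /dec pickleK.
have vol0 p : (0 <= (box_volume (bx p).1 (bx p).2)%:E)%E.
  by rewrite lee_fin box_volume_ge0.
rewrite -(esum_esum (a := fun k i => (box_volume (bx (k, i)).1 (bx (k, i)).2)%:E));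
  last by move=> *; apply: vol0.
apply: (@le_trans _ _ (\esum_(k in [set: nat]) (e / (2 ^ k.+1)%:R)%:E)%E).
  apply: le_esum => k _; rewrite esum_fset //; last exact: finite_II.
  rewrite -fsbig_ord sumEFin lee_fin; apply: le_trans (sP k).2.
  by rewrite (big_nth (0, 0)) big_mkord.
rewrite -nneseries_esumT; last by move=> k; rewrite lee_fin ltW.
(* Applied to the zero sequence, this is the bound of the geometric series by [e]. *)
have := @epsilon_trick R (fun=> 0%E) e xpredT (fun=> lexx _) (ltW e0).
rewrite [X in (_ <= X + _)%E]eseries0 // [X in (_ <= X)%E]add0e.
by apply: le_trans; rewrite (eq_eseriesr (fun k _ => add0e _)).
Qed.

(** The boxes tile a cube of side [2 * (k + 1)], so the total volume is bounded independently of
    [h]: the mesh may be chosen after the volume budget has been fixed. *)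
Lemma grid_boxes m (k h : R) : 0 <= k -> 0 < h ->
  exists s : seq ('rV[R]_m * 'rV[R]_m),
  [/\ forall x, `|x| <= k -> exists2 c, c \in s & box c.1 c.2 x,
      forall c, c \in s -> forall x y, box c.1 c.2 x -> box c.1 c.2 y ->
        `|x - y| <= h &
      \sum_(c <- s) box_volume c.1 c.2 <= (2 * (k + 1)) ^+ m].
Proof.
move=> k0 h0; pose L := k + 1; have L0 : 0 < L by rewrite ltr_wpDl.
pose N := (Num.truncn (2 * L / h)).+1; have N0 : 0 < N%:R :> R by rewrite ltr0n.
pose r := 2 * L / N%:R; have r0 : 0 < r by rewrite divr_gt0 // mulr_gt0.
have rh : r <= h.
  by rewrite /r ler_pdivrMr // -ler_pdivrMl // mulrC ltW //; exact: truncnS_gt.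
have rN : N%:R * r = 2 * L by rewrite /r mulrC divfK // gt_eqF.
pose lo (f : {ffun 'I_m -> 'I_N}) : 'rV[R]_m := \row_i (- L + r * (f i)%:R).
pose hi (f : {ffun 'I_m -> 'I_N}) : 'rV[R]_m := \row_i (- L + r * (f i).+1%:R).
exists [seq (lo f, hi f) | f <- enum {ffun 'I_m -> 'I_N}]; split.
- move=> x xk; pose f := [ffun i => inord (Num.truncn ((x 0 i + L) / r))] :
    {ffun 'I_m -> 'I_N}.
  exists (lo f, hi f); first by apply: map_f; rewrite mem_enum.
  move=> i /=; rewrite !mxE !ffunE.
  have := le_trans (rV_coord_le x i) xk; rewrite ler_norml => /andP[x1 x2].
  have t0 : 0 <= (x 0 i + L) / r by rewrite divr_ge0 // /L ?ltW //; lra.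
  rewrite inordK; last first.
    rewrite truncn_lt_nat // (ltr_pdivrMr _ _ r0) rN /L; lra.
  have := truncn_itv t0; rewrite (ler_pdivlMr _ _ r0) (ltr_pdivrMr _ _ r0).
  by set q := Num.truncn _; move=> /andP[q1 q2]; apply/andP; split; lra.
- move=> _ /mapP[f _ ->] x y xf yf; apply/rV_norm_le; first exact: ltW.
  move=> i; have := xf i; have := yf i; rewrite /= !mxE -natr1.
  move=> /andP[y1 y2] /andP[x1 x2]; apply: le_trans rh.
  by rewrite ler_norml; apply/andP; split; lra.
- rewrite big_map (eq_bigr (fun=> r ^+ m)); last first.
    move=> f _; rewrite /box_volume /= (eq_bigr (fun=> r)).
      by rewrite prodr_const card_ord.
    by move=> i _; rewrite !mxE -natr1 (_ : _ - _ = r) ?max_r ?ltW //; ring.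
  rewrite big_const_seq count_predT -cardE card_ffun !card_ord iter_addr addr0.
  by rewrite -[_ *+ _]mulr_natl natrX -exprMn rN.
Qed.

(** If [p] is small at [t0], divide [p - p.[t0]] by ['X - t0]: the quotient has the same top
    coefficient and, at distance more than [d] from [t0], is bounded by [k * (2 / d)] wherever [p]
    is small. Each of the [J] divisions contributes one point and one factor [2 / d]. *)
Lemma poly_small_cover J (p : {poly R}) d k : (size p <= J.+1)%N -> 0 < d ->
  k * (2 / d) ^+ J < `|p`_J| -> exists ts : seq R, (size ts <= J)%N /\
  forall t, `|p.[t]| <= k -> exists2 s, s \in ts & `|t - s| <= d.
Proof.
move=> + d0; elim: J p k => [|J IHJ] p k sz_p pJ.
  exists [::]; split=> // t; rewrite (size1_polyC sz_p) hornerC leNgt.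
  by rewrite expr0 mulr1 in pJ; rewrite pJ.
have [[t0 pt0]|no_t] := pselect (exists t0, `|p.[t0]| <= k); last first.
  by exists [::]; split=> // t pt; case: no_t; exists t.
have : root (p - p.[t0]%:P) t0 by rewrite /root !hornerE subrr.
move=> /factor_theorem[q qE].
have coefq j : (p - p.[t0]%:P)`_j.+1 = q`_j - q`_j.+1 * t0.
  by rewrite qE mulrBr coefB coefMX coefMC.
have coefp j : (p - p.[t0]%:P)`_j.+1 = p`_j.+1 by rewrite coefB coefC subr0.
have sz_q : (size q <= J.+1)%N.
  have [->|q0] := eqVneq q 0; first by rewrite size_poly0.
  have := congr1 (fun u : {poly R} => size u) qE.
  rewrite size_Mmonic ?monicXsubC // size_XsubC addn2 /= => sE.
  rewrite -ltnS -sE; apply: (leq_trans (size_polyD _ _)).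
  rewrite geq_max sz_p size_polyN size_polyC.
  by case: (p.[t0] != 0).
have qJ : q`_J = p`_J.+1.
  by rewrite -coefp coefq (nth_default _ sz_q) mul0r subr0.
have [|ts [sz_ts tsP]] := IHJ q (k * (2 / d)) sz_q.
  by rewrite qJ -mulrA -exprS.
exists (t0 :: ts); split=> // t pt.
have [tt0|tt0] := leP `|t - t0| d; first by exists t0; rewrite ?mem_head.
have [|s sts ts_] := tsP t; last by exists s; rewrite // inE sts orbT.
have E : p.[t] - p.[t0] = q.[t] * (t - t0).
  by have := congr1 (fun u : {poly R} => u.[t]) qE; rewrite !hornerE.
have le2 : `|q.[t]| * `|t - t0| <= 2 * k.
  by rewrite -normrM -E (le_trans (ler_normB _ _)) // mulr_natl mulr2n lerD.
rewrite mulrA ler_pdivlMr // [k * 2]mulrC; apply: le_trans le2.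
by rewrite ler_wpM2l // ltW.
Qed.

(** The first variable is singled out for the induction on the dimension. The bound [d] is uniform
    in [x], so there is a largest index whose coefficient is not identically zero. *)
Lemma polyfun_coefs {m} (f : 'rV[R]_(1 + m) -> R) : polyfun f ->
  exists d (P : 'rV[R]_m -> {poly R}),
  [/\ forall x, (size (P x) <= d)%N, forall j, polyfun (fun x => (P x)`_j) &
      forall t x, f (row_mx (const_mx t) x) = (P x).[t]].
Proof.
elim=> [c|i|g h _ [d [P [sP cP gP]]] _ [d' [Q [sQ cQ hQ]]]
       |g h _ [d [P [sP cP gP]]] _ [d' [Q [sQ cQ hQ]]]].
- exists 1, (fun=> c%:P); split=> [x|j|t x]; last by rewrite hornerC.
    by rewrite size_polyC leq_b1.
  exact: polyfun_cst.
- case: (split_ordP i) => j ->.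
    exists 2, (fun=> 'X); split=> [x|j'|t x]; first by rewrite size_polyX.
      exact: polyfun_cst.
    by rewrite row_mxEl mxE hornerX.
  exists 1, (fun x => (x 0 j)%:P); split=> [x|j'|t x].
  + by rewrite size_polyC leq_b1.
  + by under eq_fun do rewrite coefC; case: (j' == 0);
      [apply: polyfun_coord|apply: polyfun_cst].
  + by rewrite row_mxEr hornerC.
- exists (maxn d d'), (fun x => P x + Q x); split=> [x|j|t x].
  + apply: (leq_trans (size_polyD _ _)).
    by rewrite geq_max !leq_max sP sQ orbT.
  + by under eq_fun do rewrite coefD; apply: polyfun_add.
  + by rewrite hornerD gP hQ.
- exists (d + d')%N, (fun x => P x * Q x); split=> [x|j|t x].
  + apply: (leq_trans (size_polyMleq _ _)); rewrite -subn1.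
    by apply: (leq_trans (leq_subr _ _)); apply: leq_add.
  + under eq_fun do rewrite coefM; apply: polyfun_sum => l.
    exact: polyfun_mul.
  + by rewrite hornerM gP hQ.
Qed.

Lemma box_row_mx {m} (lo hi : R) (a b : 'rV[R]_m) t x :
  lo <= t <= hi -> box a b x ->
  box (row_mx (const_mx lo : 'rV_1) a) (row_mx (const_mx hi) b)
      (row_mx (const_mx t) x).
Proof.
move=> tlh xab i; case: (split_ordP i) => j ->.
  by rewrite !row_mxEl !mxE.
by rewrite !row_mxEr.
Qed.

Lemma box_volume_row_mx {m} (lo hi : R) (a b : 'rV[R]_m) : lo <= hi ->
  box_volume (row_mx (const_mx lo : 'rV_1) a) (row_mx (const_mx hi) b) =
  (hi - lo) * box_volume a b.
Proof.
move=> lh; rewrite /box_volume big_split_ord big_ord1 !row_mxEl !mxE.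
rewrite max_r ?subr_ge0 //; congr (_ * _).
by apply: eq_bigr => i _; rewrite !row_mxEr.
Qed.

End lebesgue_null.

Section polynomial_zero_set.
Context {R : realType}.

Lemma row_mx1E {m} (z : 'rV[R]_(1 + m)) :
  z = row_mx (const_mx (lsubmx z 0 0)) (rsubmx z).
Proof.
rewrite -[LHS]hsubmxK; congr row_mx.
by apply/rowP => j; rewrite !mxE !ord1.
Qed.

(** Zero sets alone do not pass through the induction: the top coefficient in the first variable
    must be bounded below off the part already covered, whence the sublevel sets. Over the boxes
    where this coefficient is small, the whole segment of the first variable is taken; elsewhere [q]
    can be small only in thin slabs around at most [J] values. *)
Lemma polyfun_sublevel_cover m (q : 'rV[R]_m -> R) (k e : R) :
  polyfun q -> (exists a, q a != 0) -> 0 <= k -> 0 < e ->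
  exists d, 0 < d /\ exists s : seq ('rV[R]_m * 'rV[R]_m),
    (forall x, `|x| <= k -> `|q x| <= d -> exists2 c, c \in s & box c.1 c.2 x) /\
    \sum_(c <- s) box_volume c.1 c.2 <= e.
Proof.
move=> + + k0; elim: m => [|m IHm] in q e *.
  move=> _ [a qa] e0; exists (`|q a| / 2); split; first by rewrite divr_gt0 ?normr_gt0.
  exists [::]; split=> [x _|]; last by rewrite big_nil ltW.
  have -> : x = a by apply/rowP => -[].
  by rewrite leNgt ltr_pdivrMr // ltr_pMr ?normr_gt0 // ltr1n.
move=> pq [a qa] e0.
have [D [P [sz_P pP qP]]] := polyfun_coefs (m := m) pq.
have ex_J : exists J, `[< exists x, (P x)`_J != 0 >].
  apply: contrapT => noJ; case/eqP: qa.
  rewrite (row_mx1E (a : 'rV_(1 + m))) qP (_ : P _ = 0) ?horner0 //.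
  apply/polyP => J; rewrite coef0; apply/eqP/negPn/negP => PJ.
  by apply: noJ; exists J; apply/asboolP; exists (rsubmx (a : 'rV_(1 + m))).
have bd_J J : `[< exists x, (P x)`_J != 0 >] -> (J <= D)%N.
  move=> /asboolP[x]; apply: contraNT; rewrite -ltnNge => /ltnW DJ.
  by rewrite (nth_default _ (leq_trans (sz_P x) DJ)).
(* [J] is the degree of [q] in the first variable; at a given [x] the coefficient of index [J] may
   still be small or zero. *)
have [J /asboolP exc maxJ] := ex_maxnP ex_J bd_J.
have sz_PJ x : (size (P x) <= J.+1)%N.
  apply/leq_sizeP => j Jj; apply/eqP/negPn/negP => Pj.
  have /maxJ : `[< exists x, (P x)`_j != 0 >] by apply/asboolP; exists x.
  by rewrite leqNgt Jj.
(* Extending boxes of total volume [e'] along a segment of length [2 * k] costs at most [e / 2]; the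
   added 1 covers [k = 0]. *)
pose e' := e / (2 * (2 * k + 1)).
have k1 : 0 < 2 * k + 1 by rewrite ltr_wpDl // mulr_ge0.
have e'0 : 0 < e' by rewrite divr_gt0 // mulr_gt0.
have [d' [d'0 [s' [s'P s'e]]]] := IHm (fun x => (P x)`_J) e' (pP J) exc e'0.
(* Slabs of half-width [sg], at most [J] over each box of the grid, have total volume at most
   [V * sg], that is [e / 2]. *)
pose V := (2 * (k + 1)) ^+ m * (2 * J.+1%:R) : R.
have V0 : 0 < V by rewrite mulr_gt0 ?exprn_gt0 ?mulr_gt0 // ltr_wpDl.
pose sg := e / (2 * V).
have sg0 : 0 < sg by rewrite divr_gt0 // mulr_gt0.
have pow0 : 0 < (2 / sg) ^+ J by rewrite exprn_gt0 // divr_gt0.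
(* With this value, the hypothesis of [poly_small_cover] becomes the lower bound [d'] on the
   coefficient. One half of [d0] is the sublevel, the other half is spent on moving [x] inside its
   box. *)
pose d0 := d' / (2 / sg) ^+ J.
have d00 : 0 < d0 by rewrite divr_gt0.
have d02 : 0 < d0 / 2 by rewrite divr_gt0.
have [h [h0 hP]] : exists h, 0 < h /\ forall x y : 'rV[R]_(1 + m), `|x| <= k ->
    `|x - y| <= h -> `|q x - q y| <= d0 / 2.
  have := uniform_continuity_ball k (polyfun_continuous pq) d02.
  move=> /(filterI (nbhs_right_gt (0 : R)))/filter_ex[h [h0 hP]].
  by exists h.
have [g [gcov gdiam gvol]] := @grid_boxes R m k h k0 h0.
(* The values found at a single point [y] of the box with large coefficient serve for all such [x]
   in the box, because [q] varies there by at most [d0 / 2]. A box without such a point takes the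
   empty list. *)
have /choice[ts tsP] (c : 'rV[R]_m * 'rV[R]_m) : exists ts : seq R,
    (size ts <= J)%N /\ (c \in g -> forall x t, `|x| <= k -> `|t| <= k ->
      d' < `|(P x)`_J| -> `|(P x).[t]| <= d0 / 2 -> box c.1 c.2 x ->
      exists2 s, s \in ts & `|t - s| <= sg).
  have [[cg [y [yk yd yc]]]|no] := pselect (c \in g /\ exists y, [/\ `|y| <= k,
      d' < `|(P y)`_J| & box c.1 c.2 y]); last first.
    exists [::]; split=> // cg x t xk _ xd _ xc; exfalso; apply: no.
    by split=> //; exists x.
  have [|ts [sz_ts tsP]] := poly_small_cover (k := d0) (sz_PJ y) sg0.
    by rewrite /d0 divfK // gt_eqF.
  exists ts; split=> // _ x t xk tk xd Pxt xc; apply: tsP.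
  have := hP (row_mx (const_mx t) x) (row_mx (const_mx t) y); rewrite !qP.
  have nx : `|row_mx (const_mx t) x : 'rV_(1 + m)| <= k.
    apply/(rV_norm_le _ k0) => i; case: (split_ordP i) => j ->.
      by rewrite row_mxEl mxE.
    by rewrite row_mxEr (le_trans (rV_coord_le _ _)).
  have nxy : `|row_mx (const_mx t) x - row_mx (const_mx t) y : 'rV_(1 + m)| <= h.
    rewrite opp_row_mx add_row_mx subrr.
    apply/(rV_norm_le _ (ltW h0)) => i; case: (split_ordP i) => j ->.
      by rewrite row_mxEl mxE normr0 ltW.
    rewrite row_mxEr; apply: (le_trans (rV_coord_le (x - y) j)).
    exact: gdiam cg _ _ xc yc.
  move=> /(_ nx nxy) le1.
  rewrite -(subrK (P x).[t] (P y).[t]) (le_trans (ler_normD _ _)) //.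
  by rewrite (splitr d0) lerD // distrC.
pose bad := [seq (row_mx (const_mx (- k)) c.1, row_mx (const_mx k) c.2) :
  'rV[R]_(1 + m) * 'rV[R]_(1 + m) | c <- s'].
pose slab (c : 'rV[R]_m * 'rV[R]_m) :=
  [seq (row_mx (const_mx (s - sg)) c.1, row_mx (const_mx (s + sg)) c.2) :
  'rV[R]_(1 + m) * 'rV[R]_(1 + m) | s <- ts c].
exists (d0 / 2); split=> //; exists (bad ++ flatten [seq slab c | c <- g]); split.
- move=> z zk qz.
  pose t := (lsubmx (z : 'rV_(1 + m))) 0 0; pose x := rsubmx (z : 'rV_(1 + m)).
  have zE : z = row_mx (const_mx t) x :> 'rV_(1 + m) := row_mx1E _.
  have xk : `|x| <= k.
    apply/(rV_norm_le _ k0) => i; rewrite mxE.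
    exact: le_trans (rV_coord_le _ _) zk.
  have tk : `|t| <= k by rewrite /t mxE; apply: le_trans (rV_coord_le _ _) zk.
  move: qz; rewrite zE qP => Pxt.
  have [cx|cx] := leP `|(P x)`_J| d'.
    have [c cs' xc] := s'P x xk cx.
    exists (row_mx (const_mx (- k) : 'rV_1) c.1, row_mx (const_mx k : 'rV_1) c.2).
      by rewrite mem_cat; apply/orP; left; apply/mapP; exists c.
    by apply: box_row_mx => //; rewrite -ler_norml.
  have [c cg xc] := gcov x xk.
  have [s sts ts_] := (tsP c).2 cg x t xk tk cx Pxt xc.
  exists (row_mx (const_mx (s - sg) : 'rV_1) c.1,
          row_mx (const_mx (s + sg) : 'rV_1) c.2).
    rewrite mem_cat; apply/orP; right; apply/flatten_mapP; exists c => //.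
    by apply/mapP; exists s.
  by apply: box_row_mx => //; rewrite -ler_distlC distrC.
- rewrite big_cat /= (splitr e); apply: lerD.
    rewrite big_map (eq_bigr (fun c => (2 * k) * box_volume c.1 c.2)); last first.
      move=> c _; rewrite box_volume_row_mx; first by congr (_ * _); ring.
      by apply: (@le_trans _ _ 0); rewrite ?oppr_le0.
    rewrite -mulr_sumr.
    apply: (@le_trans _ _ (2 * k * e')); first by rewrite ler_wpM2l // mulr_ge0.
    apply: (@le_trans _ _ ((2 * k + 1) * e')).
      by rewrite ler_wpM2r ?ltW // ltrDl.
    by rewrite le_eqVlt; apply/orP; left; apply/eqP; rewrite /e'; field; rewrite gt_eqF.
  rewrite big_flatten /= big_map.
  apply: (@le_trans _ _ (\sum_(c <- g) (2 * J.+1%:R * sg) * box_volume c.1 c.2)).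
    apply: ler_sum => c _; rewrite big_map.
    rewrite (eq_bigr (fun=> (2 * sg) * box_volume c.1 c.2)); last first.
      move=> s _; rewrite box_volume_row_mx; first by congr (_ * _); ring.
      by rewrite lerD2l ge0_cp // ltW.
    rewrite big_const_seq count_predT iter_addr addr0 -[_ *+ _]mulr_natl.
    rewrite mulrA ler_wpM2r ?box_volume_ge0 // mulrCA -mulrA.
    rewrite ler_wpM2l // ler_wpM2r ?(ltW sg0) // ler_nat.
    exact: leq_trans (tsP c).1 _.
  rewrite -mulr_sumr.
  apply: (@le_trans _ _ (2 * J.+1%:R * sg * (2 * (k + 1)) ^+ m)).
    by apply: ler_wpM2l => //; rewrite mulr_ge0 ?(ltW sg0).
  rewrite le_eqVlt; apply/orP; left; apply/eqP.
  rewrite /sg /V; field.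
  rewrite addrC natr1 pnatr_eq0 expf_neq0 // gt_eqF // mulr_gt0 //.
  by rewrite ltr_wpDl.
Qed.

Lemma polyfun_zeros_null m (q : 'rV[R]_m -> R) :
  polyfun q -> (exists a, q a != 0) -> lebesgue_outer [set x | q x = 0] = 0%E.
Proof.
move=> pq nq; apply: lebesgue_outer_null => k e e0.
have [d [d0 [s [sP se]]]] := polyfun_sublevel_cover pq nq (ler0n R k) e0.
by exists s; split=> // x /= qx xk; apply: sP => //; rewrite qx normr0 ltW.
Qed.

Lemma lebesgue_outer_sub {m} (A B : set 'rV[R]_m) :
  A `<=` B -> (lebesgue_outer A <= lebesgue_outer B)%E.
Proof.
move=> AB; apply: ereal_inf_le_tmp => _ [D [a [b [BD ->]]]].
by exists D, a, b; split=> //; apply: subset_trans BD.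
Qed.

Lemma lebesgue_outer_ge0 {m} (A : set 'rV[R]_m) : (0 <= lebesgue_outer A)%E.
Proof.
apply: le_ereal_inf_tmp => _ [D [a [b [_ ->]]]]; apply: esum_ge0 => k _.
by rewrite lee_fin box_volume_ge0.
Qed.

End polynomial_zero_set.

(** * Critical points of the tilted functions *)

Section slices.
Context {R : realType} {V W : normedModType R}.

Lemma diff_slice (f : V * W -> R) x y : differentiable f (x, y) ->
  differentiable (fun w => f (x, w)) y /\
  forall v, 'd (fun w => f (x, w)) y v = 'd f (x, y) (0, v).
Proof.
move=> df; have dp : is_diff y (fun w : W => (x, w)) (fun v => (0, v)).
  exact: (is_diff_pair (is_diff_cst x y) (is_diff_id y)).
have df' : is_diff ((fun w : W => (x, w)) y) f ('d f (x, y)) by split.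
have [d1 d2] := is_diff_comp dp df'.
by split=> // v; exact: (congr1 (fun h => h v) d2).
Qed.

Lemma C1_slice (f : V * W -> R) x : C1 f -> C1 (fun w => f (x, w)).
Proof.
move=> [df cf]; split=> [y|v]; first by have [] := diff_slice (df (x, y)).
rewrite (_ : (fun p => _) = (fun p => 'd f p (0, v)) \o (fun w => (x, w))).
  move=> y; apply: continuous_comp; last exact: cf.
  by apply: cvg_pair; [exact: cvg_cst|exact: cvg_id].
apply/funext => y; have [_ dE] := diff_slice (df (x, y)).
exact: dE.
Qed.

Lemma C2_slice (f : V * W -> R) x : C2 f -> C2 (fun w => f (x, w)).
Proof.
move=> [df cf]; split=> [y|v]; first by have [] := diff_slice (df (x, y)).
rewrite (_ : (fun p => _) = (fun w => 'd f (x, w) (0, v))).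
  exact: (C1_slice _ (cf _)).
apply/funext => y; have [_ dE] := diff_slice (df (x, y)).
exact: dE.
Qed.

Lemma diff_sub_linear (f : V -> R) (L : {linear V -> R^o}) p :
  continuous L -> differentiable f p ->
  differentiable (fun z => f z - L z) p /\
  forall v, 'd (fun z => f z - L z) p v = 'd f p v - L v.
Proof.
move=> cL df; have iL : is_diff p L L.
  by split; [exact: linear_differentiable|exact: diff_lin].
have idf : is_diff p f ('d f p) by split.
have [d1 d2] := is_diffB idf iL.
by split=> // v; exact: (congr1 (fun h => h v) d2).
Qed.

Lemma diff_sub_cst (f : V -> R) c p : differentiable f p ->
  differentiable (fun z => f z - c) p /\
  forall v, 'd (fun z => f z - c) p v = 'd f p v.
Proof.
move=> df; have idf : is_diff p f ('d f p) by split.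
have [d1 d2] := is_diffB idf (is_diff_cst c p).
by split=> // v; exact: etrans (congr1 (fun h => h v) d2) (subr0 _).
Qed.

Lemma C2_sub_linear (f : V -> R) (L : {linear V -> R^o}) :
  continuous L -> C2 f -> C2 (fun z => f z - L z).
Proof.
move=> cL [df cf]; split=> [p|v]; first by have [] := diff_sub_linear cL (df p).
rewrite (_ : (fun p => _) = (fun p => 'd f p v - L v)); last first.
  by apply/funext => p; have [_ dE] := diff_sub_linear cL (df p); exact: dE.
have [dfv cfv] := cf v; split=> [p|w].
  by have [] := diff_sub_cst (L v) (dfv p).
have E : (fun p => 'd (fun q => 'd f q v - L v) p w) =
    (fun p => 'd (fun q => 'd f q v) p w).
  by apply/funext => p; have [_ dE] := diff_sub_cst (L v) (dfv p); exact: dE.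
by rewrite E; exact: cfv.
Qed.

(** Supplies the squared form of differentiability consumed by [semialgebraic_derivative]: the
    tolerance becomes [Num.sqrt e] and the radius is squared. *)
Lemma derivative_estimate (f : V -> R) p v (e : R) : differentiable f p -> 0 < e ->
  exists c : R, 0 < c /\ forall h : R, h != 0 -> h ^+ 2 < c ->
    (f (p + h *: v) - f p - 'd f p v * h) ^+ 2 <= e * h ^+ 2.
Proof.
move=> df e0; have se0 : 0 < Num.sqrt e by rewrite sqrtr_gt0.
have lim : h^-1 *: ((f \o shift p) (h *: v) - f p) @[h --> 0^'] --> ('d f p v : R).
  by rewrite -deriveE //; apply: (diff_derivable (v := v) df).
have /= [d d0 dP] := cvgr_dist_le _ _ lim _ se0.
exists (d ^+ 2); split; first by rewrite exprn_gt0.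
move=> h h0 hd; have := dP h; rewrite /= sub0r normrN => /(_ _ h0).
have hd' : `|h| < d.
  by rewrite -(ltr_pXn2r (n := 2)) // ?nnegrE ?ltW // real_normK ?num_real.
move=> /(_ hd'); rewrite [p + _]addrC.
set D := 'd f p v; set F := f _ - f p => le1.
have -> : F - D * h = - ((D - h^-1 * F) * h).
  by rewrite mulrBl mulrAC mulVf // mul1r opprB.
rewrite sqrrN exprMn ler_wpM2r ?sqr_ge0 // -[e]sqr_sqrtr ?(ltW e0) //.
by rewrite -[leLHS]real_normK ?num_real // ler_pXn2r ?nnegrE ?(ltW se0).
Qed.

End slices.

Section tilted_function.
Context {R : realType} {n m : nat}.
Variable g : 'rV[R]_n * 'rV[R]_m -> R.
Hypothesis C2g : C2 g.

(** Taken from the differential of [g] on the product space, so as to be a function of [(x, y)]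
    jointly, whose graph is semialgebraic in both variables. *)
Definition ygrad (j : 'I_m) z : R := 'd g z (0, delta_mx 0 j).

Definition yhess (i j : 'I_m) z : R := 'd (ygrad j) z (0, delta_mx 0 i).

Lemma inner_linear (a : 'rV[R]_m) :
  linear_for *:%R (fun z : 'rV[R]_n * 'rV[R]_m => inner a z.2 : R^o).
Proof.
move=> c z w; rewrite /inner scaler_sumr -big_split /=; apply: eq_bigr => i _.
by rewrite !mxE mulrDr mulrCA.
Qed.

Lemma inner_continuous (a : 'rV[R]_m) :
  continuous (fun z : 'rV[R]_n * 'rV[R]_m => inner a z.2).
Proof.
have pa : polyfun (inner a).
  apply: polyfun_sum => i; apply: polyfun_mul; last exact: polyfun_coord.
  exact: polyfun_cst.
move=> z; apply: (@continuous_comp _ _ _ snd (inner a)); first exact: cvg_snd.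
exact: polyfun_continuous.
Qed.

Lemma C2_tilt a : C2 (fun z => g z - inner a z.2).
Proof.
pose L := GRing.isLinear.Build R ('rV[R]_n * 'rV[R]_m)%type R^o *:%R _
  (inner_linear a).
pose l : {linear _ -> _} :=
  HB.pack (fun z : 'rV[R]_n * 'rV[R]_m => inner a z.2 : R^o) L.
exact: (@C2_sub_linear _ _ g l (@inner_continuous a) C2g).
Qed.

Lemma diff_tilt_slice a x y v :
  'd (fun w => g (x, w) - inner a w) y v = 'd g (x, y) (0, v) - inner a v.
Proof.
have [dh _] := C2_tilt a; have [dg _] := C2g.
have [_ ->] := diff_slice (dh (x, y)).
pose L := GRing.isLinear.Build R ('rV[R]_n * 'rV[R]_m)%type R^o *:%R _
  (inner_linear a).
pose l : {linear _ -> _} :=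
  HB.pack (fun z : 'rV[R]_n * 'rV[R]_m => inner a z.2 : R^o) L.
by have [_ /(_ (0, v))] := diff_sub_linear (L := l) (@inner_continuous a) (dg (x, y)).
Qed.

Lemma inner_delta (a : 'rV[R]_m) j : inner a (delta_mx 0 j) = a 0 j.
Proof.
rewrite /inner (bigD1 j) //= big1 ?addr0 => [|i ij]; first by rewrite mxE !eqxx mulr1.
by rewrite mxE (negPf ij) andbF mulr0.
Qed.

Lemma C1_ygrad j : C1 (ygrad j).
Proof. exact: C2g.2. Qed.

Lemma partial_tilt a x j :
  partial j (fun y => g (x, y) - inner a y) = fun y => ygrad j (x, y) - a 0 j.
Proof.
apply/funext => y; rewrite /partial deriveE; last exact: (C2_slice x (C2_tilt a)).1.
by rewrite diff_tilt_slice inner_delta.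
Qed.

Lemma hessian_tilt a x y :
  hessian (fun y => g (x, y) - inner a y) y = \matrix_(i, j) yhess i j (x, y).
Proof.
apply/matrixP => i j; rewrite !mxE partial_tilt.
have [d1 dE] := diff_slice ((C1_ygrad j).1 (x, y)).
have [d2 dE2] := diff_sub_cst (a 0 j) d1.
by rewrite /partial deriveE //; exact: etrans (dE2 _) (dE _).
Qed.

(** Tilting shifts the gradient by [a] and leaves the Hessian unchanged, so that [a] enters the
    degeneracy condition only as the prescribed value of the gradient of [g]. *)
Lemma morse_tilt a x : morse (fun y => g (x, y) - inner a y) <->
  ~ exists y, (forall j, ygrad j (x, y) = a 0 j) /\
     \det (\matrix_(i, j) yhess i j (x, y)) = 0.
Proof.
split=> [[_ mo] [y [gy dy]]|no].
  have := mo y; rewrite hessian_tilt unitmxE unitfE dy eqxx.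
  suff -> : grad (fun y => g (x, y) - inner a y) y = 0 by move=> /(_ erefl).
  by apply/rowP => j; rewrite !mxE partial_tilt gy subrr.
split; first exact: (C2_slice x (C2_tilt a)).
move=> y gy; rewrite hessian_tilt unitmxE unitfE; apply/eqP => dy; apply: no.
exists y; split=> // j; move/rowP: gy => /(_ j); rewrite !mxE partial_tilt.
by move=> /eqP; rewrite subr_eq0 => /eqP.
Qed.

End tilted_function.

Section critical_values.
Context {R : realType} {n m : nat}.
Variable g : 'rV[R]_n * 'rV[R]_m -> R.
Hypothesis C2g : C2 g.
Hypothesis sg : semialgebraic_fun g.

Let pr (z : 'rV[R]_(n + m)) := (lsubmx z, rsubmx z).

Lemma semialgebraic_diff (f d : 'rV[R]_n * 'rV[R]_m -> R) (v : 'rV[R]_m) :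
  (forall p, differentiable f p) -> (forall p, d p = 'd f p (0, v)) ->
  semialgebraic_scalar (fun z => f (pr z)) ->
  semialgebraic_scalar (fun z => d (pr z)).
Proof.
move=> df dE sf; apply: (semialgebraic_derivative (v := row_mx 0 v) sf).
move=> x e e0; have [c [c0 cP]] := derivative_estimate (0, v) (df (pr x)) e0.
exists c; split=> // h h0 hc; have := cP h h0 hc.
have -> : pr (x + h *: row_mx 0 v) = pr x + h *: (0, v).
  by rewrite /pr !linearD !linearZ /= row_mxKl row_mxKr.
by rewrite dE.
Qed.

Lemma semialgebraic_scalar_pair {k} (f : 'rV[R]_n * 'rV[R]_m -> R)
    (X : 'rV[R]_k -> 'rV[R]_n) (Y : 'rV[R]_k -> 'rV[R]_m) :
  semialgebraic_scalar (fun z => f (pr z)) ->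
  semialgebraic_map X -> semialgebraic_map Y ->
  semialgebraic_scalar (fun z => f (X z, Y z)).
Proof.
move=> sf sX sY.
have := semialgebraic_scalar_comp (semialgebraic_map_row_mx sX sY) sf.
congr semialgebraic_scalar; apply/funext => z.
by rewrite /pr row_mxKl row_mxKr.
Qed.

Lemma semialgebraic_ygrad j : semialgebraic_scalar (fun z => ygrad g j (pr z)).
Proof.
apply: (semialgebraic_diff (f := g) (v := delta_mx 0 j)) => //.
  exact: C2g.1.
exact: semialgebraic_fun_scalar.
Qed.

Lemma semialgebraic_yhess i j :
  semialgebraic_scalar (fun z => yhess g i j (pr z)).
Proof.
apply: (semialgebraic_diff (f := ygrad g j) (v := delta_mx 0 i)) => //.
  exact: (C1_ygrad C2g j).1.
exact: semialgebraic_ygrad.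
Qed.

Definition critical_at (x : 'rV[R]_n) (y a : 'rV[R]_m) :=
  (forall j, ygrad g j (x, y) = a 0 j) /\
  \det (\matrix_(i, j) yhess g i j (x, y)) = 0.

(** Arbitrary maps as arguments allow the condition to be read on any blocks of coordinates, and
    also with [x] held constant. *)
Lemma semialgebraic_critical_at {k} (X : 'rV[R]_k -> 'rV[R]_n)
    (Y A : 'rV[R]_k -> 'rV[R]_m) :
  semialgebraic_map X -> semialgebraic_map Y -> semialgebraic_map A ->
  semialgebraic [set z | critical_at (X z) (Y z) (A z)].
Proof.
move=> sX sY sA; apply: semialgebraic_and.
  apply: semialgebraic_forall_fin => j; apply: semialgebraic_eq; last first.
    exact: semialgebraic_scalar_coord.
  exact: semialgebraic_scalar_pair (semialgebraic_ygrad j) sX sY.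
apply: semialgebraic_eq; last exact: semialgebraic_scalar_cst.
(* The determinant unfolds to its Leibniz expansion. *)
apply: semialgebraic_scalar_sum => s; apply: semialgebraic_scalar_mul.
  exact: semialgebraic_scalar_cst.
apply: semialgebraic_scalar_prod => i; under eq_fun do rewrite mxE.
exact: semialgebraic_scalar_pair (semialgebraic_yhess i _) sX sY.
Qed.

Definition critical_values : set 'rV[R]_(n + m) :=
  [set z | exists y, critical_at (lsubmx z) y (rsubmx z)].

Lemma semialgebraic_id k : semialgebraic_map (@id 'rV[R]_k).
Proof. exact: semialgebraic_map_poly polymap_id. Qed.

Lemma semialgebraic_critical_values : semialgebraic critical_values.
Proof.
apply: semialgebraic_exists; apply: semialgebraic_critical_at.
- apply: (semialgebraic_map_lsubmx (F := fun z => lsubmx z)).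
  exact/semialgebraic_map_lsubmx/semialgebraic_id.
- exact/semialgebraic_map_rsubmx/semialgebraic_id.
- apply: (semialgebraic_map_rsubmx (F := fun z => lsubmx z)).
  exact/semialgebraic_map_lsubmx/semialgebraic_id.
Qed.

(** [sard_ball] treats only bounded [y]. The bound [t] on [y] is made the first coordinate of [W],
    stated by inequalities on coordinates to be semialgebraic; the sections of [W] increase with [t]
    and [semialgebraic_increasing_thin] handles their union. *)
Lemma critical_values_thin x (a : 'rV[R]_m) :
  ~ nbhs a [set b | critical_values (row_mx x b)].
Proof.
pose W : set 'rV[R]_(1 + m) := [set w | exists y : 'rV[R]_m,
  (forall i, - lsubmx w 0 0 <= y 0 i /\ y 0 i <= lsubmx w 0 0) /\
  critical_at x y (rsubmx w)].
have sW : semialgebraic W.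
  apply: semialgebraic_exists; apply: semialgebraic_and.
    apply: semialgebraic_forall_fin => i.
    have st : semialgebraic_scalar
        (fun z : 'rV[R]_(1 + m + m) => lsubmx (lsubmx z) 0 0).
      apply: (semialgebraic_scalar_coord (F := fun z => lsubmx (lsubmx z))).
      apply: (semialgebraic_map_lsubmx (F := fun z => lsubmx z)).
      exact/semialgebraic_map_lsubmx/semialgebraic_id.
    have sy : semialgebraic_scalar (fun z : 'rV[R]_(1 + m + m) => rsubmx z 0 i).
      exact/semialgebraic_scalar_coord/semialgebraic_map_rsubmx/semialgebraic_id.
    apply: semialgebraic_and; apply: semialgebraic_le => //.
    exact: semialgebraic_scalar_opp.
  apply: semialgebraic_critical_at.
  - by apply: semialgebraic_map_poly => i; apply: polyfun_cst.
  - exact/semialgebraic_map_rsubmx/semialgebraic_id.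
  - apply: (semialgebraic_map_rsubmx (F := fun z => lsubmx z)).
    exact/semialgebraic_map_lsubmx/semialgebraic_id.
move=> na; apply: (semialgebraic_increasing_thin sW _ _ (a := a)).
- move=> t t' b tt' [y [yt yc]]; exists y; split; last first.
    by move: yc; rewrite !row_mxKr.
  move=> i; have := yt i; rewrite !row_mxKl !mxE => -[y1 y2].
  by split; [apply: le_trans y1; rewrite lerN2|apply: le_trans tt'].
- move=> t b nb.
  apply: (@sard_ball _ _ (fun j y => ygrad g j (x, y)) `|t| _ b).
    by move=> j; apply: C1_slice; apply: C1_ygrad.
  apply: filterS nb => c [y [yt]]; rewrite row_mxKr => -[yg yh].
  exists y; split=> //.
    apply/rV_norm_le => // i; apply: le_trans (ler_norm t).
    by have [] := yt i; rewrite row_mxKl mxE ler_norml => -> ->.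
  (* [yhess i j] differentiates the [j]-th gradient component in direction [i], so it is the
     transpose of the Jacobian in [sard_ball]. *)
  rewrite -yh -det_tr; congr (\det _); apply/matrixP => i j; rewrite !mxE.
  have [_ ->] := diff_slice ((C1_ygrad C2g j).1 (x, y)); by [].
- apply: filterS na => b [y]; rewrite row_mxKl row_mxKr => yc.
  exists `|y|, y; rewrite row_mxKl row_mxKr mxE; split=> // i.
  by apply/andP; rewrite -ler_norml rV_coord_le.
Qed.

End critical_values.

(** * The set of vectors with piecewise parametric Morse tilt *)

Section tilted_morse.
Context {R : realType} {n m : nat}.
Variable g : 'rV[R]_n * 'rV[R]_m -> R.
Hypothesis C2g : C2 g.
Hypothesis sg : semialgebraic_fun g.

Let A : set 'rV[R]_m :=
  [set a | piecewise_parametric_morse (fun z => g z - inner a z.2)].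

Lemma morse_critical_values a x :
  morse (fun y => g (x, y) - inner a y) <-> ~ critical_values g (row_mx x a).
Proof.
have := morse_tilt C2g a x.
by rewrite /critical_values /critical_at /= row_mxKl row_mxKr.
Qed.

Lemma open_dense_morse_set a (U : set 'rV[R]_n) : open U -> dense U ->
  (forall x, U x -> ~ critical_values g (row_mx x a)) -> A a.
Proof.
move=> oU dU UP; split; first exact: C2_tilt.
by exists U; split=> // x /UP nS; apply/morse_critical_values.
Qed.

(** A quantifier over open dense sets is not first-order. It is replaced by the density of the
    interior of the set of good [x], written with balls of the maximum norm, so that only points and
    radii are quantified. *)
Lemma semialgebraic_morse_set : semialgebraic A.
Proof.
pose near k (r : R) (x y : 'rV[R]_k) :=
  forall i, y 0 i < x 0 i + r /\ x 0 i < y 0 i + r.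
have nearE k (x y : 'rV[R]_k) r : 0 < r -> near k r x y <-> ball x r y.
  move=> r0; split=> [xy|/rV_ballE[_ xy] i].
    apply/rV_ballE; split=> // i; have [l1 l2] := xy i.
    by rewrite ltr_norml; apply/andP; split; lra.
  by have := xy i; rewrite ltr_norml => /andP[l1 l2]; split; lra.
have snear p k (X Y : 'rV[R]_p -> 'rV[R]_k) r :
    semialgebraic_map X -> semialgebraic_map Y -> semialgebraic_scalar r ->
    semialgebraic [set z | near k (r z) (X z) (Y z)].
  move=> sX sY sr; apply: semialgebraic_forall_fin => i; apply: semialgebraic_and;
    apply: semialgebraic_lt; try exact: semialgebraic_scalar_coord;
    by apply: semialgebraic_scalar_add => //; apply: semialgebraic_scalar_coord.
have -> : A = [set a | forall (x : 'rV[R]_n) (r : R), 0 < r ->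
    exists x' : 'rV[R]_n, near n r x x' /\ exists r' : R, 0 < r' /\
      forall x'' : 'rV[R]_n, near n r' x' x'' ->
        ~ critical_values g (row_mx x'' a)].
  rewrite predeqE => a; split=> [[_ [U [oU dU mU]]] x r r0|aP].
    have [|x' [xx' Ux']] := dU (ball x r)^° _ (open_interior _).
      exists x; exact: (nbhsx_ballx x r r0).
    have Un : nbhs x' U by apply: open_nbhs_nbhs.
    exists x'; split; first by apply/(nearE _ _ _ _ r0); apply: interior_subset.
    move/nbhs_ballP: Un => [r' /= r'0 r'U]; exists r'; split=> // x'' /(nearE _ _ _ _ r'0).
    by move=> /r'U/mU/morse_critical_values.
  apply: (@open_dense_morse_set a [set x | ~ critical_values g (row_mx x a)]^°).
  - exact: open_interior.
  - move=> V [x Vx] oV.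
    have /nbhs_ballP[r /= r0 rV] : nbhs x V by apply: open_nbhs_nbhs.
    have [x' [/(nearE _ _ _ _ r0)/rV Vx' [r' [r'0 r'P]]]] := aP x r r0.
    exists x'; split=> //; apply/nbhs_ballP; exists r' => // x''.
    by move=> /(nearE _ _ _ _ r'0); apply: r'P.
  - by move=> x /interior_subset.
have sid := semialgebraic_id.
(* The blocks of coordinates accumulate in the order [a], [x], [r], [x'], [r'], [x'']; a variable is
   reached by one [lsubmx] for each block to its right. *)
apply: semialgebraic_forall; apply: semialgebraic_forallR.
apply: semialgebraic_imply.
  apply: semialgebraic_lt; first exact: semialgebraic_scalar_cst.
  exact/semialgebraic_scalar_coord/semialgebraic_map_rsubmx.
apply: semialgebraic_exists; apply: semialgebraic_and.
  apply: snear.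
  - apply: (semialgebraic_map_rsubmx (F := fun z => lsubmx (lsubmx z))).
    apply: (semialgebraic_map_lsubmx (F := fun z => lsubmx z)).
    exact: semialgebraic_map_lsubmx.
  - exact: semialgebraic_map_rsubmx.
  - apply: (semialgebraic_scalar_coord (F := fun z => rsubmx (lsubmx z))).
    apply: (semialgebraic_map_rsubmx (F := fun z => lsubmx z)).
    exact: semialgebraic_map_lsubmx.
apply: semialgebraic_existsR; apply: semialgebraic_and.
  apply: semialgebraic_lt; first exact: semialgebraic_scalar_cst.
  exact/semialgebraic_scalar_coord/semialgebraic_map_rsubmx.
apply: semialgebraic_forall; apply: semialgebraic_imply.
  apply: snear.
  - apply: (semialgebraic_map_rsubmx (F := fun z => lsubmx (lsubmx z))).
    apply: (semialgebraic_map_lsubmx (F := fun z => lsubmx z)).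
    exact: semialgebraic_map_lsubmx.
  - exact: semialgebraic_map_rsubmx.
  - apply: (semialgebraic_scalar_coord (F := fun z => rsubmx (lsubmx z))).
    apply: (semialgebraic_map_rsubmx (F := fun z => lsubmx z)).
    exact: semialgebraic_map_lsubmx.
apply: semialgebraic_not.
apply: (semialgebraic_comp (P := fun z => critical_values g z)
  (F := fun z => row_mx (rsubmx z) (lsubmx (lsubmx (lsubmx (lsubmx (lsubmx z))))))).
  apply: semialgebraic_map_row_mx; first exact: semialgebraic_map_rsubmx.
  apply: (semialgebraic_map_lsubmx (F := fun z => lsubmx (lsubmx (lsubmx (lsubmx z))))).
  apply: (semialgebraic_map_lsubmx (F := fun z => lsubmx (lsubmx (lsubmx z)))).
  apply: (semialgebraic_map_lsubmx (F := fun z => lsubmx (lsubmx z))).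
  apply: (semialgebraic_map_lsubmx (F := fun z => lsubmx z)).
  exact: semialgebraic_map_lsubmx.
exact: semialgebraic_critical_values.
Qed.

Lemma polyfun_nonzero_open_dense {k} (q : 'rV[R]_k -> R) :
  polyfun q -> (exists a, q a != 0) ->
  open [set x | q x != 0] /\ dense [set x | q x != 0].
Proof.
move=> pq [a qa]; split.
  apply: (@open_comp _ _ q [set r | r != 0]); last exact: open_neq.
  by move=> x _; apply: polyfun_continuous.
move=> V [x Vx] oV.
have Vn : nbhs x V by apply: open_nbhs_nbhs.
by have [z Vz qz] := polyfun_nonzero_near pq qa Vn; exists z.
Qed.

Lemma morse_set_polynomial : exists q : 'rV[R]_m -> R,
  [/\ polyfun q, exists a, q a != 0 & [set a | q a != 0] `<=` A].
Proof.
have [|q [pq nq qP]] :=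
  semialgebraic_thin_fibers (semialgebraic_critical_values C2g sg).
  exact: critical_values_thin.
exists q; split; [exact: pq|exact: nq|move=> a /qP[P [pP nP PS]]].
have [oP dP] := polyfun_nonzero_open_dense pP nP.
apply: (open_dense_morse_set oP dP) => x /eqP Px Sx; apply: Px; exact: PS.
Qed.

End tilted_morse.

Theorem proposition3p4 (R : realType) (n m : nat)
    (g : 'rV[R]_n * 'rV[R]_m -> R) (hC2 : C2 g) (hg : semialgebraic_fun g) :
  let A : set 'rV[R]_m :=
    [set a | piecewise_parametric_morse (fun z => g z - inner a z.2)] in
  [/\ semialgebraic A, dense A, residual A & full_measure A].
Proof.
move=> A; have [q [pq nq qA]] := morse_set_polynomial hC2 hg.
have [oq dq] := polyfun_nonzero_open_dense pq nq.
split.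
- exact: semialgebraic_morse_set.
- move=> V V0 oV; have [a [Va qa]] := dq V V0 oV.
  by exists a; split; [exact: Va|exact: qA].
(* A single open dense set lies inside [A], so a constant sequence suffices. *)
- exists (fun=> [set a | q a != 0]); split; first by move=> _; split.
  by move=> a qa; apply: qA; exact: (qa 0).
- apply/eqP; rewrite eq_le lebesgue_outer_ge0 andbT -(polyfun_zeros_null pq nq).
  apply: lebesgue_outer_sub => a nAa; apply/eqP/negPn/negP => qa.
  by apply: nAa; exact: qA.
Qed.
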